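(* For a positive integer $n$, let $f(n)$ denote the minimum, over all colourings of the edges of the complete graph $K_n$ with two colours, of the maximum number of pairwise edge-disjoint monochromatic triangles in that colouring. Then $f(n) \ge n^2/12 - o(n^2)$ as $n \to \infty$; that is, every $2$-colouring of the edges of $K_n$ contains a collection of $n^2/12 + o(n^2)$ pairwise edge-disjoint monochromatic triangles.
   Context: A triangle is monochromatic if all three of its edges receive the same colour. Two triangles are edge-disjoint if they share no edge. *)

(* Defs.v *)
From mathcomp Require Import all_boot all_order all_algebra.
Set Implicit Arguments. Unset Strict Implicit. Unset Printing Implicit Defensive.

(* Vertices of K_n are 'I_n; edges are the 2-element subsets of 'I_n.
   A 2-colouring of the edges of K_n is a function from sets of vertices to
   bool; only its values on 2-element sets matter. *)
Definition colouring (n : nat) := {set 'I_n} -> bool.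

Definition triangle n (T : {set 'I_n}) : bool := #|T| == 3.

Definition monochromatic n (c : colouring n) (T : {set 'I_n}) : bool :=
  [forall e : {set 'I_n}, forall e' : {set 'I_n},
     ((e \subset T) && (#|e| == 2) && (e' \subset T) && (#|e'| == 2))
       ==> (c e == c e')].

Definition edge_disjoint n (T1 T2 : {set 'I_n}) : bool :=
  [forall e : {set 'I_n}, (#|e| == 2) ==> ~~ ((e \subset T1) && (e \subset T2))].

Definition edm_triangles n (c : colouring n) (S : {set {set 'I_n}}) : Prop :=
  (forall T, T \in S -> triangle T && monochromatic c T) /\
  (forall T1 T2, T1 \in S -> T2 \in S -> T1 != T2 -> edge_disjoint T1 T2).

(* Main.v *)
(* By linear programming duality, the largest fractional packing of monochromatic
   triangles in a vertex set [S] equals the weight of a smallest fractional cover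
   [y] of them by edges. If such covers weighed less than (1/12 - eps) n^2 for large
   n, then for some S an optimal cover would have all degrees below lam |S| with
   lam < 1/6: deleting a vertex leaves a cover. By complementary slackness fewer than
   |S|^2/4 edges would have positive weight, so by Mantel's theorem there is a
   triangle all of whose edges have weight zero. It is not monochromatic. A vertex
   outside it sends it weight at least 1 unless its three edges to the triangle follow
   one of three colour patterns; averaging the covering inequalities over these three
   zones of vertices forces lam >= 1/6, up to lower order terms.

   Averaging fractional packings of all k-subsets gives a fractional packing of K_n
   in which each triangle has weight O(k/n), and a weighted Roedl nibble turns it into
   edge-disjoint triangles while losing only o(n^2). *)

Require Import Defs.
From mathcomp Require Import all_boot all_order all_algebra.
From mathcomp Require Import ring lra.
Set Implicit Arguments. Unset Strict Implicit. Unset Printing Implicit Defensive.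
Import Order.TTheory GRing.Theory Num.Theory.
Local Open Scope ring_scope.

(** * The zones around a triangle of weight zero *)

(** The constant 1/12 is half of 1/6, the least possible value of maximum degree over [#|S|]. The
    degrees of the zero triangle alone cannot show this, because a vertex in one of the three zones
    may send it almost nothing. So degrees of vertices inside the zones are added as well. The total
    multiplicity is six, and every vertex has to contribute one unit, up to lower order terms. The
    extra weight 13/7 sits at the vertex whose two triangle edges have the same colour. The best
    zone for the additional test vertices depends on the relative sizes of the zones, whence the
    subdivision into strips with separate linear certificates.

    The nibble proves no concentration of degrees. It takes expectations and one second moment,
    keeps a single outcome at least as good as the mean, and trims the weight wherever a degree
    exceeds 1. Progress is measured by the loss [alpha] allowed per vertex of the hypergraph: one
    step improves [alpha] to [alpha - alpha ^+ 2 / 64], so finitely many steps lead from the trivial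
    value 1 to any positive value. *)

(* Mean values over three zones [a], [b], [c] of vertices: [Yxy] is the mean weight
   of an edge from zone [x] to zone [y]; [Ax], [Bx], [Cx] are the mean weights of
   the edges from zone [x] to the three vertices of a triangle of weight zero. *)
Record profile (R : Type) := Profile {
  Yaa : R; Yab : R; Yac : R; Ybb : R; Ybc : R; Ycc : R;
  Aa : R; Ab : R; Ac : R; Ba : R; Bb : R; Bc : R; Ca : R; Cb : R; Cc : R }.

Definition swap_profile (R : Type) (P : profile R) : profile R :=
  Profile (Yaa P) (Yac P) (Yab P) (Ycc P) (Ybc P) (Ybb P)
    (Aa P) (Ac P) (Ab P) (Ca P) (Cc P) (Cb P) (Ba P) (Bc P) (Bb P).

Definition nonneg_profile (R : realFieldType) (P : profile R) : Prop :=
  [/\ [/\ 0 <= Yaa P, 0 <= Yab P, 0 <= Yac P & [/\ 0 <= Ybb P, 0 <= Ybc P & 0 <= Ycc P]],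
      [/\ 0 <= Aa P, 0 <= Ab P & 0 <= Ac P],
      [/\ 0 <= Ba P, 0 <= Bb P & 0 <= Bc P] &
      [/\ 0 <= Ca P, 0 <= Cb P & 0 <= Cc P]].

(** Each line is the mean of an inequality valid for at most three points of the zones. The
    remaining constraints arise by exchanging zones [b] and [c], which is what [swap_profile]
    does. *)
Definition half_system (R : realFieldType) (P : profile R) : Prop :=
  [/\ [/\ 3 <= 3 * Yaa P + 6 * Yab P + 2 * Aa P + 3 * Ab P + 12 / 5 * Bb P,
          50 / 13 <= 2 * Yaa P + 6 * Yab P + 2 * Aa P + 2 * Ba P + 3 * Ab P + 3 * Bb P,
          1 <= Yaa P + 2 * Yab P + 2 * Aa P + Ab P &
          1 <= Ybb P + 2 * Yab P + Aa P + 2 * Ab P],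
      [/\ 1 <= 3 * Ybb P + 3 * Ab P,
          1 <= Ybb P + 2 * Ybc P + 2 * Ab P + Ac P,
          1 <= 3 * Yaa P + 3 * Ba P &
          2 <= 3 * Yaa P + 3 * Aa P + 3 * Ba P] &
      [/\ 2 <= Ybb P + 2 * Yab P + Aa P + 2 * Ab P + Ba P + 2 * Bb P,
          1 <= 3 * Ybb P + 3 * Cb P,
          1 <= Yab P + Aa P + Ab P + Ba P + Bb P &
          1 <= Ybb P + 2 * Bb P + 2 * Cb P]].

(* A deficit against the target of one unit per vertex when the degrees of the zero
   triangle are counted with multiplicities 13/7, 1, 1 and those of test vertices,
   distributed as [(ma, mb, mc)] over the zones, with multiplicity 15/7: six in
   total. The multiplicities were found by linear programming. *)
Definition slack_a (R : realFieldType) (P : profile R) (ma mb mc : R) :=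
  13 / 7 * Aa P + Ba P + Ca P - 1
  + 15 / 7 * (ma * Yaa P + mb * Yab P + mc * Yac P).
Definition slack_b (R : realFieldType) (P : profile R) (ma mb mc : R) :=
  13 / 7 * Ab P + Bb P + Cb P - 1
  + 15 / 7 * (ma * Yab P + mb * Ybb P + mc * Ybc P).
Definition slack_c (R : realFieldType) (P : profile R) (ma mb mc : R) :=
  13 / 7 * Ac P + Bc P + Cc P - 1
  + 15 / 7 * (ma * Yac P + mb * Ybc P + mc * Ycc P).

(** Sizes are normalised by [nb + nc = 1]: [x] is the share of zone [b], [t] the size of zone [a],
    and the tests are split as [(0, s, 1 - s)]. *)
Definition corner (R : realFieldType) (P : profile R) (s x t : R) : Prop :=
  0 <= t * slack_a P 0 s (1 - s)
       + (x * slack_b P 0 s (1 - s) + (1 - x) * slack_c P 0 s (1 - s)).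

(** The form is linear, so its values at the corners of a trapezoid decide: for [La >= 0] the two
    bottom corners suffice, for [La < 0] the two top ones do. *)
Lemma strip_nonneg (R : realFieldType) (La Lb Lc a b c x1 x2 t1 t2 : R) :
    x1 < x2 -> 0 <= 0 * La + (x1 * Lb + (1 - x1) * Lc) ->
    0 <= 0 * La + (x2 * Lb + (1 - x2) * Lc) ->
    0 <= t1 * La + (x1 * Lb + (1 - x1) * Lc) ->
    0 <= t2 * La + (x2 * Lb + (1 - x2) * Lc) ->
    x1 * (b + c) <= b -> b <= x2 * (b + c) -> 0 <= a ->
    (x2 - x1) * a <= t1 * (x2 * (b + c) - b) + t2 * (b - x1 * (b + c)) ->
  0 <= a * La + b * Lb + c * Lc.
Proof.
rewrite mul0r !add0r => lt12 bot1 bot2 top1 top2 b1 b2 a0 ub.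
have d0 : 0 < x2 - x1 by rewrite subr_gt0.
have p1 : 0 <= x2 * (b + c) - b by rewrite subr_ge0.
have p2 : 0 <= b - x1 * (b + c) by rewrite subr_ge0.
rewrite -(pmulr_rge0 _ d0).
have [La0|La0] := lerP 0 La.
  rewrite [leRHS](_ : _ = (x2 - x1) * a * La
    + ((x2 * (b + c) - b) * (x1 * Lb + (1 - x1) * Lc)
       + (b - x1 * (b + c)) * (x2 * Lb + (1 - x2) * Lc))); last by ring.
  by rewrite !addr_ge0 // mulr_ge0 // mulr_ge0 // ltW.
rewrite [leRHS](_ : _ = (x2 * (b + c) - b) * (t1 * La + (x1 * Lb + (1 - x1) * Lc))
  + (b - x1 * (b + c)) * (t2 * La + (x2 * Lb + (1 - x2) * Lc))
  + (t1 * (x2 * (b + c) - b) + t2 * (b - x1 * (b + c)) - (x2 - x1) * a) * - La);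
  last by ring.
by rewrite !addr_ge0 // mulr_ge0 // ?subr_ge0 // oppr_ge0 ltW.
Qed.


(** For [nc <= nb] the region above the broken line is the cone spanned by these four size vectors,
    the first being the direction of zone [a] alone. *)
Lemma corners_a (R : realFieldType) (P : profile R) :
    nonneg_profile P -> half_system P -> half_system (swap_profile P) ->
  [/\ 0 <= slack_a P 1 0 0,
      0 <= 13 / 25 * slack_a P 1 0 0 + (1 / 2 * slack_b P 1 0 0 + 1 / 2 * slack_c P 1 0 0),
      0 <= 13 / 25 * slack_a P 1 0 0 + (4 / 5 * slack_b P 1 0 0 + 1 / 5 * slack_c P 1 0 0) &
      0 <= 61 / 100 * slack_a P 1 0 0 + slack_b P 1 0 0].
Proof.
case: P => yaa yab yac ybb ybc ycc aa ab ac ba bb bc ca cb cc.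
rewrite /nonneg_profile /half_system /slack_a /slack_b /slack_c /=.
move=> [[? ? ? [? ? ?]] [? ? ?] [? ? ?] [? ? ?]].
move=> [[? ? ? ?] [? ? ? ?] [? ? ? ?]] [[? ? ? ?] [? ? ? ?] [? ? ? ?]].
split; lra.
Qed.

Lemma corners (R : realFieldType) (P : profile R) :
    nonneg_profile P -> half_system P -> half_system (swap_profile P) ->
  [/\ [/\ corner P (1 / 2) (1 / 2) 0, corner P (1 / 2) (3 / 5) 0,
          corner P (1 / 2) (1 / 2) (13 / 25) & corner P (1 / 2) (3 / 5) (13 / 25)],
      [/\ corner P (7 / 10) (3 / 5) 0, corner P (7 / 10) (5 / 7) 0,
          corner P (7 / 10) (3 / 5) (13 / 25) & corner P (7 / 10) (5 / 7) (13 / 25)],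
      [/\ corner P (4 / 5) (5 / 7) 0, corner P (4 / 5) (4 / 5) 0,
          corner P (4 / 5) (5 / 7) (13 / 25) & corner P (4 / 5) (4 / 5) (13 / 25)] &
      [/\ corner P (9 / 10) (4 / 5) 0, corner P (9 / 10) (14 / 15) 0,
          corner P (9 / 10) (4 / 5) (13 / 25) & corner P (9 / 10) (14 / 15) (29 / 50)] /\
      [/\ corner P 1 (14 / 15) 0, corner P 1 1 0,
          corner P 1 (14 / 15) (29 / 50) & corner P 1 1 (61 / 100)]].
Proof.
case: P => yaa yab yac ybb ybc ycc aa ab ac ba bb bc ca cb cc.
rewrite /nonneg_profile /half_system /corner /slack_a /slack_b /slack_c /=.
move=> [[? ? ? [? ? ?]] [? ? ?] [? ? ?] [? ? ?]].
move=> [[? ? ? ?] [? ? ? ?] [? ? ? ?]] [[? ? ? ?] [? ? ? ?] [? ? ? ?]].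
by split; do 2?split; lra.
Qed.

(* The deficit is linear in the zone sizes, so it is enough to look at the corners
   of a subdivision. Below the broken line with ordinates 13/25, 29/50, 61/100 the
   shares [nb : nc] are cut into five strips, each with its own tests
   [(0, s, 1 - s)]; above it the tests lie in zone [a]. *)
Lemma half_certificate (R : realFieldType) (P : profile R) (na nb nc M : R) :
    nonneg_profile P -> half_system P -> half_system (swap_profile P) ->
    [/\ 0 <= na, 0 <= nc, nc <= nb & 0 <= M] ->
    (0 < na -> na * Yaa P + nb * Yab P + nc * Yac P <= M) ->
    (0 < nb -> na * Yab P + nb * Ybb P + nc * Ybc P <= M) ->
    (0 < nc -> na * Yac P + nb * Ybc P + nc * Ycc P <= M) ->
  na + nb + nc <= na * (13 / 7 * Aa P + Ba P + Ca P)
    + nb * (13 / 7 * Ab P + Bb P + Cb P)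
    + nc * (13 / 7 * Ac P + Bc P + Cc P) + 15 / 7 * M.
Proof.
move=> P0 hP hP' [na0 nc0 ncb M0] Ma Mb Mc.
have [cor1 cor2 cor3 [cor4 cor5]] := corners P0 hP hP'.
have [a0 a1 a2 a3] := corners_a P0 hP hP'; clear P0 hP hP'.
have nb0 := le_trans nc0 ncb.
(* The broken line is the maximum of two linear forms. They agree at [nb = 4 * nc], and the second
   passes through the ordinates 29/50 and 61/100 at shares 14/15 and 1. *)
have boundary : (13 / 25 * (nb + nc) <= na /\ 61 / 100 * nb + 4 / 25 * nc <= na)
    \/ na < 13 / 25 * (nb + nc) \/ na < 61 / 100 * nb + 4 / 25 * nc.
  have [h1|h1] := lerP (13 / 25 * (nb + nc)) na; last by right; left.
  by have [h2|h2] := lerP (61 / 100 * nb + 4 / 25 * nc) na; [left|right; right].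
case: boundary => [[big1 big2]|small].
  have [na_gt0|na_le0] := ltP 0 na; last first.
    have e1 : na = 0 by lra.
    have e2 : nb = 0 by lra.
    have e3 : nc = 0 by lra.
    by rewrite e1 e2 e3; lra.
  have {}Ma := Ma na_gt0; clear Mb Mc cor1 cor2 cor3 cor4 cor5.
  suff : 0 <= na * slack_a P 1 0 0 + nb * slack_b P 1 0 0 + nc * slack_c P 1 0 0.
    by rewrite /slack_a /slack_b /slack_c; lra.
  move: (slack_a P 1 0 0) (slack_b P 1 0 0) (slack_c P 1 0 0) a0 a1 a2 a3.
  move=> la lb lc a0 a1 a2 a3 {Ma}.
  have [le4|gt4] := lerP nb (4 * nc).
    have p1 : 0 <= na - 13 / 25 * (nb + nc) by rewrite subr_ge0.
    have p2 : 0 <= 4 / 5 * (nb + nc) - nb by lra.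
    have p3 : 0 <= nb - 1 / 2 * (nb + nc) by lra.
    have := mulr_ge0 p1 a0; have := mulr_ge0 p2 a1; have := mulr_ge0 p3 a2; lra.
  have p1 : 0 <= na - (61 / 100 * nb + 4 / 25 * nc) by rewrite subr_ge0.
  have p2 : 0 <= nb - 4 * nc by lra.
  have := mulr_ge0 p1 a0; have := mulr_ge0 nc0 a2; have := mulr_ge0 p2 a3; lra.
clear Ma a0 a1 a2 a3.
have nb_gt0 : 0 < nb by clear cor1 cor2 cor3 cor4 cor5; case: small; lra.
have {}Mb := Mb nb_gt0.
have fin s : 0 <= s -> s <= 1 -> (s < 1 -> na * Yac P + nb * Ybc P + nc * Ycc P <= M) ->
    0 <= na * slack_a P 0 s (1 - s) + nb * slack_b P 0 s (1 - s) + nc * slack_c P 0 s (1 - s) ->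
  na + nb + nc <= na * (13 / 7 * Aa P + Ba P + Ca P)
    + nb * (13 / 7 * Ab P + Bb P + Cb P)
    + nc * (13 / 7 * Ac P + Bc P + Cc P) + 15 / 7 * M.
  move=> s0; rewrite le_eqVlt => /orP[/eqP->|s1] {}Mc; clear cor1 cor2 cor3 cor4 cor5.
    by rewrite /slack_a /slack_b /slack_c; lra.
  have s1' : 0 <= 1 - s by lra.
  have := ler_wpM2l s0 Mb; have := ler_wpM2l s1' (Mc s1).
  by clear; rewrite /slack_a /slack_b /slack_c; lra.
(* A test in zone [c] needs that zone to be nonempty. This is why the strip with share of [b] at
   least 14/15 uses [s = 1], with no test in [c]. *)
have {}Mc : nb < 14 * nc -> na * Yac P + nb * Ybc P + nc * Ycc P <= M.
  by move=> lt; apply: Mc; clear -nb_gt0 lt; lra.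
have [le1|gt1] := lerP (14 * nc) nb.
  apply: (fin 1); [exact: ler01|exact: lexx|by rewrite ltxx|].
  case: cor5 => c1 c2 c3 c4; apply: (strip_nonneg _ c1 c2 c3 c4) => //;
    clear -na0 nc0 nb0 ncb small le1;
    lra || (case: small; lra).
have {}fin s (s0 : 0 <= s) (s1 : s <= 1) := fin s s0 s1 (fun=> Mc gt1).
have [le2|gt2] := lerP (4 * nc) nb.
  apply: (fin (9 / 10)); [clear; lra|clear; lra|].
  case: cor4 => c1 c2 c3 c4; apply: (strip_nonneg _ c1 c2 c3 c4) => //;
    clear -na0 nc0 nb0 ncb small le2 gt1;
    lra || (case: small; lra).
have [le3|gt3] := lerP (5 / 2 * nc) nb.
  apply: (fin (4 / 5)); [clear; lra|clear; lra|].
  case: cor3 => c1 c2 c3 c4; apply: (strip_nonneg _ c1 c2 c3 c4) => //;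
    clear -na0 nc0 nb0 ncb small le3 gt2;
    lra || (case: small; lra).
have [le4|gt4] := lerP (3 / 2 * nc) nb.
  apply: (fin (7 / 10)); [clear; lra|clear; lra|].
  case: cor2 => c1 c2 c3 c4; apply: (strip_nonneg _ c1 c2 c3 c4) => //;
    clear -na0 nc0 nb0 ncb small le4 gt3;
    lra || (case: small; lra).
apply: (fin (1 / 2)); [clear; lra|clear; lra|].
case: cor1 => c1 c2 c3 c4; apply: (strip_nonneg _ c1 c2 c3 c4) => //;
    clear -na0 nc0 nb0 ncb small gt4;
    lra || (case: small; lra).
Qed.

Lemma certificate (R : realFieldType) (P : profile R) (na nb nc M : R) :
    nonneg_profile P -> half_system P -> half_system (swap_profile P) ->
    [/\ 0 <= na, 0 <= nb, 0 <= nc & 0 <= M] ->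
    (0 < na -> na * Yaa P + nb * Yab P + nc * Yac P <= M) ->
    (0 < nb -> na * Yab P + nb * Ybb P + nc * Ybc P <= M) ->
    (0 < nc -> na * Yac P + nb * Ybc P + nc * Ycc P <= M) ->
  na + nb + nc <= na * (13 / 7 * Aa P + Ba P + Ca P)
    + nb * (13 / 7 * Ab P + Bb P + Cb P)
    + nc * (13 / 7 * Ac P + Bc P + Cc P) + 15 / 7 * M.
Proof.
move=> P0 hP hP' [na0 nb0 nc0 M0] Ma Mb Mc.
have [cb|/ltW bc] := lerP nc nb; first exact: half_certificate.
suff : na + nc + nb <= na * (13 / 7 * Aa P + Ca P + Ba P)
    + nc * (13 / 7 * Ac P + Cc P + Bc P)
    + nb * (13 / 7 * Ab P + Cb P + Bb P) + 15 / 7 * M by clear; lra.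
apply: (@half_certificate _ (swap_profile P)) => //=.
- by case: P0 => [[? ? ? [? ? ?]] [? ? ?] [? ? ?] [? ? ?]].
- by move=> /Ma; clear; lra.
- by move=> /Mc; clear; lra.
- by move=> /Mb; clear; lra.
Qed.

(** * Covering inequalities on triples of points and their averages *)

(** One edge of the colour covered by [x] already gives 1; if there is none, the triangle is
    monochromatic. *)
Lemma triangle_one (R : realFieldType) (r12 r13 r23 : bool)
    (y12 y13 y23 x1 x2 x3 : R) :
    [/\ 0 <= y12, 0 <= y13 & 0 <= y23] -> [/\ 0 <= x1, 0 <= x2 & 0 <= x3] ->
    (r12 -> 1 <= y12 + x1 + x2) -> (r13 -> 1 <= y13 + x1 + x3) ->
    (r23 -> 1 <= y23 + x2 + x3) ->
    (r12 = r13 -> r13 = r23 -> 1 <= y12 + y13 + y23) ->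
  1 <= y12 + y13 + y23 + (x1 + x2 + x3).
Proof.
case: r12; case: r13; case: r23 => -[? ? ?] [? ? ?] p12 p13 p23 mono;
  do ?[have {}p12 := p12 isT]; do ?[have {}p13 := p13 isT];
  do ?[have {}p23 := p23 isT]; do ?[have {}mono := mono erefl erefl]; lra.
Qed.

(** If both colours occur, two distinct edges give 1 each. If only one does, the three edge
    inequalities together with the monochromatic one sum to twice the claim. *)
Lemma triangle_two (R : realFieldType) (r12 r13 r23 : bool)
    (y12 y13 y23 x1 x2 x3 z1 z2 z3 : R) :
    [/\ 0 <= y12, 0 <= y13 & 0 <= y23] -> [/\ 0 <= x1, 0 <= x2 & 0 <= x3] ->
    [/\ 0 <= z1, 0 <= z2 & 0 <= z3] ->
    (r12 -> 1 <= y12 + x1 + x2) -> (r13 -> 1 <= y13 + x1 + x3) ->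
    (r23 -> 1 <= y23 + x2 + x3) ->
    (~~ r12 -> 1 <= y12 + z1 + z2) -> (~~ r13 -> 1 <= y13 + z1 + z3) ->
    (~~ r23 -> 1 <= y23 + z2 + z3) ->
    (r12 = r13 -> r13 = r23 -> 1 <= y12 + y13 + y23) ->
  2 <= y12 + y13 + y23 + (x1 + x2 + x3) + (z1 + z2 + z3).
Proof.
case: r12; case: r13; case: r23 => -[? ? ?] [? ? ?] [? ? ?];
  move=> p12 p13 p23 q12 q13 q23 mono;
  do ?[have {}p12 := p12 isT]; do ?[have {}p13 := p13 isT];
  do ?[have {}p23 := p23 isT]; do ?[have {}q12 := q12 isT];
  do ?[have {}q13 := q13 isT]; do ?[have {}q23 := q23 isT];
  do ?[have {}mono := mono erefl erefl]; lra.
Qed.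

(* The bounds [13 / 7 * x + z <= 1] hold outside the vertices that already pay
   their share; here they keep two blue edges at the same vertex from being
   covered by [x] alone. *)
Lemma triangle_capped (R : realFieldType) (r12 r13 r23 : bool)
    (y12 y13 y23 x1 x2 x3 z1 z2 z3 u1 u2 : R) :
    [/\ 0 <= y12, 0 <= y13 & 0 <= y23] -> [/\ 0 <= x1, 0 <= x2 & 0 <= x3] ->
    [/\ 0 <= z1, 0 <= z2 & 0 <= z3] -> 0 <= u1 -> 0 <= u2 ->
    [/\ 13 / 7 * x1 + z1 + u1 <= 1, 13 / 7 * x2 + z2 + u2 <= 1 &
        13 / 7 * x3 + z3 <= 1] ->
    (~~ r12 -> 1 <= y12 + x1 + x2) -> (~~ r13 -> 1 <= y13 + x1 + x3) ->
    (~~ r23 -> 1 <= y23 + x2 + x3) ->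
    (r12 -> 1 <= y12 + z1 + z2) -> (r13 -> 1 <= y13 + z1 + z3) ->
    (r23 -> 1 <= y23 + z2 + z3) -> (r12 -> 1 <= y12 + u1 + u2) ->
    (r12 = r13 -> r13 = r23 -> 1 <= y12 + y13 + y23) ->
  3 <= 3 * y12 + 3 * y13 + 3 * y23 + (x1 + x2 + 3 * x3) + 12 / 5 * z3 /\
  50 / 13 <= 2 * y12 + 3 * y13 + 3 * y23 + (x1 + x2 + 3 * x3) + (z1 + z2 + 3 * z3).
Proof.
case: r12; case: r13; case: r23 => -[? ? ?] [? ? ?] [? ? ?] ? ? [? ? ?];
  move=> p12 p13 p23 q12 q13 q23 w12 mono;
  do ?[have {}p12 := p12 isT]; do ?[have {}p13 := p13 isT];
  do ?[have {}p23 := p23 isT]; do ?[have {}q12 := q12 isT]; do ?[have {}w12 := w12 isT];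
  do ?[have {}q13 := q13 isT]; do ?[have {}q23 := q23 isT];
  do ?[have {}mono := mono erefl erefl]; split; lra.
Qed.

(* [None] is a phantom point standing for an empty zone. *)
Definition mean (R : realFieldType) (I : finType) (X : {set I}) (f : option I -> R) : R :=
  if X == set0 then f None else (\sum_(i in X) f (Some i)) / #|X|%:R.

Definition in_zone (I : finType) (X : {set I}) (o : option I) : bool :=
  if o is Some i then i \in X else true.

Lemma mean_sum (R : realFieldType) (I : finType) (X : {set I}) (f : option I -> R) :
  \sum_(i in X) f (Some i) = #|X|%:R * mean X f.
Proof.
rewrite /mean; case: eqVneq => [->|X0]; first by rewrite cards0 mul0r big_set0.
by rewrite mulrCA mulfV ?mulr1 // pnatr_eq0 cards_eq0.
Qed.

Lemma mean_cst (R : realFieldType) (I : finType) (X : {set I}) (c : R) :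
  mean X (fun=> c) = c.
Proof.
rewrite /mean; case: eqVneq => // X0.
by rewrite sumr_const -[c *+ _]mulr_natr mulfK // pnatr_eq0 cards_eq0.
Qed.

Lemma meanD (R : realFieldType) (I : finType) (X : {set I}) (f g : option I -> R) :
  mean X (fun o => f o + g o) = mean X f + mean X g.
Proof. by rewrite /mean; case: eqP => // _; rewrite big_split mulrDl. Qed.

Lemma meanZ (R : realFieldType) (I : finType) (X : {set I}) (c : R) (f : option I -> R) :
  mean X (fun o => c * f o) = c * mean X f.
Proof. by rewrite /mean; case: eqP => // _; rewrite -mulr_sumr mulrA. Qed.

Lemma le_mean (R : realFieldType) (I : finType) (X : {set I}) (f g : option I -> R) :
  (forall o, in_zone X o -> f o <= g o) -> mean X f <= mean X g.
Proof.
move=> fg; rewrite /mean; case: eqP => _; first exact: fg.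
by rewrite ler_wpM2r ?invr_ge0 ?ler0n // ler_sum // => i Xi; apply: fg.
Qed.

Lemma mean_le_cst (R : realFieldType) (I : finType) (X : {set I}) (f : option I -> R) (c : R) :
  X != set0 -> (forall i, i \in X -> f (Some i) <= c) -> mean X f <= c.
Proof.
move=> X0 fc; have X_gt0 : 0 < (#|X|%:R : R) by rewrite ltr0n card_gt0.
rewrite -(ler_pM2l X_gt0) -mean_sum (le_trans (ler_sum _ fc)) //.
by rewrite sumr_const mulr_natl.
Qed.

Lemma eq_mean (R : realFieldType) (I : finType) (X : {set I}) (f g : option I -> R) :
  f =1 g -> mean X f = mean X g.
Proof.
by move=> fg; rewrite /mean fg; under eq_bigr do rewrite fg.
Qed.

Lemma mean_exchange (R : realFieldType) (I : finType) (X Y : {set I})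
    (f : option I -> option I -> R) :
  mean X (fun o => mean Y (f o)) = mean Y (fun o' => mean X (f^~ o')).
Proof.
rewrite /mean; case: eqP => _; case: eqP => _ //.
rewrite -!mulr_suml exchange_big /= -!mulrA; congr (_ * _); exact: mulrC.
Qed.

Definition mean2 (R : realFieldType) (I : finType) (X Y : {set I})
  (f : option I -> option I -> R) : R := mean X (fun o => mean Y (f o)).

(** The three points are drawn independently, and the zones may be equal, so the pointwise
    inequality is also required when points coincide. *)
Lemma mean3_ge (R : realFieldType) (I : finType) (X Y Z : {set I})
    (y : option I -> option I -> R) (c k12 k13 k23 : R) (f g h : option I -> R) :
    (forall o1 o2 o3, in_zone X o1 -> in_zone Y o2 -> in_zone Z o3 ->
      c <= k12 * y o1 o2 + k13 * y o1 o3 + k23 * y o2 o3 + (f o1 + g o2 + h o3)) ->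
  c <= k12 * mean2 X Y y + k13 * mean2 X Z y + k23 * mean2 Y Z y
       + (mean X f + mean Y g + mean Z h).
Proof.
move=> ineq.
have -> : k12 * mean2 X Y y + k13 * mean2 X Z y + k23 * mean2 Y Z y
    + (mean X f + mean Y g + mean Z h)
  = mean X (fun o1 => mean Y (fun o2 => mean Z (fun o3 =>
      k12 * y o1 o2 + k13 * y o1 o3 + k23 * y o2 o3 + (f o1 + g o2 + h o3)))).
  rewrite [RHS](@eq_mean _ _ X _ (fun o1 => k12 * mean Y (y o1) + k13 * mean Z (y o1)
    + k23 * mean2 Y Z y + (f o1 + mean Y g + mean Z h))).
    by rewrite !(meanD, meanZ, mean_cst).
  move=> o1; rewrite [LHS](@eq_mean _ _ Y _ (fun o2 => k12 * y o1 o2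
    + k13 * mean Z (y o1) + k23 * mean Z (y o2) + (f o1 + g o2 + mean Z h))).
    by rewrite !(meanD, meanZ, mean_cst).
  by move=> o2; rewrite !(meanD, meanZ, mean_cst).
rewrite -(mean_cst X c); apply: le_mean => o1 X1.
rewrite -(mean_cst Y c); apply: le_mean => o2 Y2.
rewrite -(mean_cst Z c); apply: le_mean => o3 Z3; exact: ineq.
Qed.

(* [a], [b], [c] are the zones of the vertices joined to the three vertices of
   the zero triangle by blue-red-red, blue-red-blue and blue-blue-red edges, and
   [A], [B], [C] are the weights of those three edges. *)
Definition zone_axioms (R : realFieldType) (T : Type) (y : T -> T -> R)
    (red : T -> T -> bool) (A B C : T -> R) (a b c : T -> bool) : Prop :=
  [/\ [/\ forall o o', 0 <= y o o', forall o, [/\ 0 <= A o, 0 <= B o & 0 <= C o],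
          forall o o', y o o' = y o' o &
          forall o, [|| a o, b o | c o] -> 13 / 7 * A o + B o + C o <= 1],
      forall o o', [|| a o, b o | c o] -> [|| a o', b o' | c o'] ->
        ~~ red o o' -> 1 <= y o o' + A o + A o',
      [/\ forall o o', a o || b o -> a o' || b o' ->
            red o o' -> 1 <= y o o' + B o + B o',
          forall o o', a o || c o -> a o' || c o' ->
            red o o' -> 1 <= y o o' + C o + C o',
          forall o o', b o -> b o' -> ~~ red o o' -> 1 <= y o o' + C o + C o' &
          forall o o', c o -> c o' -> ~~ red o o' -> 1 <= y o o' + B o + B o'] &
      forall o1 o2 o3, [|| a o1, b o1 | c o1] -> [|| a o2, b o2 | c o2] ->
        [|| a o3, b o3 | c o3] -> red o1 o2 = red o1 o3 -> red o1 o3 = red o2 o3 ->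
        1 <= y o1 o2 + y o1 o3 + y o2 o3].

Lemma zone_axioms_swap (R : realFieldType) (T : Type) (y : T -> T -> R)
    (red : T -> T -> bool) (A B C : T -> R) (a b c : T -> bool) :
  zone_axioms y red A B C a b c -> zone_axioms y red A C B a c b.
Proof.
move=> [[y0 ABC0 ysym cap] blueA [redB redC blueC blueB] mono].
have q o : [|| a o, c o | b o] -> [|| a o, b o | c o] by rewrite [c o || _]orbC.
split; [split=> // o|move=> o o' /q qo /q|split=> //|move=> o1 o2 o3 /q q1 /q q2 /q]; last exact: mono.
- by case: (ABC0 o).
- by move=> /q /cap; rewrite addrAC.
- exact: blueA.
Qed.

Definition lift2 (T S : Type) (d : S) (f : T -> T -> S) (o o' : option T) : S :=
  if (o, o') is (Some i, Some j) then f i j else d.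

(** The phantom point has edge weight 1 to everything and sends 0 to the triangle, so every covering
    inequality involving it holds by its edges alone, and the cap holds as well. *)
Lemma zone_axioms_lift (R : realFieldType) (I : finType) (y : I -> I -> R)
    (red : I -> I -> bool) (A B C : I -> R) (X Y Z : {set I}) :
    zone_axioms y red A B C [in X] [in Y] [in Z] ->
  zone_axioms (lift2 1 y) (lift2 true red) (oapp A 0) (oapp B 0) (oapp C 0)
    (in_zone X) (in_zone Y) (in_zone Z).
Proof.
move=> [[y0 ABC0 ysym cap] blueA [redB redC blueC blueB] mono].
have nn o : [/\ 0 <= oapp A 0 o, 0 <= oapp B 0 o & 0 <= oapp C 0 o].
  by case: o => [i|] //=; exact: ABC0.
have ny o o' : 0 <= lift2 1 y o o' by case: o o' => [i|] [j|] //=; exact: y0.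
have ge1 (u v : R) : 0 <= u -> 0 <= v -> 1 <= 1 + u + v.
  by move=> u0 v0; rewrite -addrA lerDl addr_ge0.
have [nA nB nC] : [/\ forall o, 0 <= oapp A 0 o, forall o, 0 <= oapp B 0 o &
    forall o, 0 <= oapp C 0 o] by split=> o; case: (nn o).
split; [split=> //| |split|].
- by move=> [i|] [j|]; rewrite /lift2.
- by move=> [i|] /=; [exact: cap|move=> _; lra].
- by move=> [i|] [j|] //= qi qj; exact: blueA.
- by move=> [i|] [j|] qi qj re; first exact: redB; exact: ge1 (nB _) (nB _).
- by move=> [i|] [j|] qi qj re; first exact: redC; exact: ge1 (nC _) (nC _).
- by move=> [i|] [j|] //= qi qj re; exact: blueC.
- by move=> [i|] [j|] //= qi qj re; exact: blueB.
move=> o1 o2 o3; have := (ny o2 o3); have := (ny o1 o3); have := (ny o1 o2).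
case: o1 o2 o3 => [i|] [j|] [k|] h12 h13 h23 qi qj qk e1 e2; first exact: mono.
all: by move: h12 h13 h23; rewrite /lift2 /=; clear; lra.
Qed.

(** The colours of the pairs vary from triple to triple; [triangle_one], [triangle_two] and
    [triangle_capped] provide bounds free of the colours, and only such bounds can be averaged. *)
Lemma zone_half_system (R : realFieldType) (I : finType)
    (y : option I -> option I -> R) (red : option I -> option I -> bool)
    (A B C : option I -> R) (X Y Z : {set I}) :
    zone_axioms y red A B C (in_zone X) (in_zone Y) (in_zone Z) ->
  half_system (Profile (mean2 X X y) (mean2 X Y y) (mean2 X Z y)
    (mean2 Y Y y) (mean2 Y Z y) (mean2 Z Z y) (mean X A) (mean Y A) (mean Z A)
    (mean X B) (mean Y B) (mean Z B) (mean X C) (mean Y C) (mean Z C)).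
Proof.
move=> [[y0 ABC0 ysym cap] blueA [redB redC blueC blueB] mono].
have [nA nB nC] : [/\ forall o, 0 <= A o, forall o, 0 <= B o & forall o, 0 <= C o].
  by split=> o; case: (ABC0 o).
pose q o := [|| in_zone X o, in_zone Y o | in_zone Z o].
have qX o : in_zone X o -> q o by rewrite /q => ->.
have qY o : in_zone Y o -> q o by rewrite /q => ->; rewrite orbT.
have qZ o : in_zone Z o -> q o by rewrite /q => ->; rewrite !orbT.
pose p o := in_zone X o || in_zone Y o.
have pX o : in_zone X o -> p o by rewrite /p => ->.
have pY o : in_zone Y o -> p o by rewrite /p => ->; rewrite orbT.
have pq o : p o -> q o by rewrite /p /q orbA => ->.
have monoN o1 o2 o3 : q o1 -> q o2 -> q o3 -> ~~ red o1 o2 = ~~ red o1 o3 ->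
    ~~ red o1 o3 = ~~ red o2 o3 -> 1 <= y o1 o2 + y o1 o3 + y o2 o3.
  by move=> ? ? ? /negb_inj ? /negb_inj ?; exact: mono.
have triA o1 o2 o3 : q o1 -> q o2 -> q o3 ->
    1 <= y o1 o2 + y o1 o3 + y o2 o3 + (A o1 + A o2 + A o3).
  move=> q1 q2 q3; apply: (@triangle_one _ (~~ red o1 o2) (~~ red o1 o3) (~~ red o2 o3));
    by [split|exact: blueA|exact: monoN].
have triAB o1 o2 o3 : p o1 -> p o2 -> p o3 ->
    2 <= y o1 o2 + y o1 o3 + y o2 o3 + (B o1 + B o2 + B o3) + (A o1 + A o2 + A o3).
  move=> p1 p2 p3; have [q1 q2 q3] := And3 (pq _ p1) (pq _ p2) (pq _ p3).
  apply: (@triangle_two _ (red o1 o2) (red o1 o3) (red o2 o3));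
    by [split|exact: blueA|exact: redB|exact: mono].
have triB o1 o2 o3 : p o1 -> p o2 -> p o3 ->
    1 <= y o1 o2 + y o1 o3 + y o2 o3 + (B o1 + B o2 + B o3).
  move=> p1 p2 p3; have [q1 q2 q3] := And3 (pq _ p1) (pq _ p2) (pq _ p3).
  apply: (@triangle_one _ (red o1 o2) (red o1 o3) (red o2 o3));
    by [split|exact: redB|exact: mono].
have triC o1 o2 o3 : in_zone Y o1 -> in_zone Y o2 -> in_zone Y o3 ->
    1 <= y o1 o2 + y o1 o3 + y o2 o3 + (C o1 + C o2 + C o3).
  move=> p1 p2 p3; have [q1 q2 q3] := And3 (qY _ p1) (qY _ p2) (qY _ p3).
  apply: (@triangle_one _ (~~ red o1 o2) (~~ red o1 o3) (~~ red o2 o3));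
    by [split|exact: blueC|exact: monoN].
have capped o1 o2 o3 : in_zone X o1 -> in_zone X o2 -> in_zone Y o3 ->
   3 <= 3 * y o1 o2 + 3 * y o1 o3 + 3 * y o2 o3
     + (A o1 + A o2 + 3 * A o3) + 12 / 5 * B o3 /\
   50 / 13 <= 2 * y o1 o2 + 3 * y o1 o3 + 3 * y o2 o3
     + (A o1 + A o2 + 3 * A o3) + (B o1 + B o2 + 3 * B o3).
  move=> x1 x2 x3; have [q1 q2 q3] := And3 (qX _ x1) (qX _ x2) (qY _ x3).
  apply: (@triangle_capped _ (red o1 o2) (red o1 o3) (red o2 o3) _ _ _ _ _ _ _ _ _ (C o1) (C o2)).
  - by split.
  - by split.
  - by split.
  - by [].
  - by [].
  - split; [exact: cap|exact: cap|]; apply: le_trans (cap _ q3).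
    by rewrite lerDl.
  - exact: blueA.
  - exact: blueA.
  - exact: blueA.
  - by apply: redB; [exact: pX|exact: pX].
  - by apply: redB; [exact: pX|exact: pY].
  - by apply: redB; [exact: pX|exact: pY].
  - by apply: redC; rewrite ?x1 ?x2.
  - exact: mono.
have pairAB o1 o2 : p o1 -> p o2 -> 1 <= y o1 o2 + (A o1 + B o1) + (A o2 + B o2).
  move=> p1 p2; have := (nA o1, nA o2); have := (nB o1, nB o2) => -[? ?] [? ?].
  have [r12|r12] := boolP (red o1 o2); first by have := redB _ _ p1 p2 r12; lra.
  by have := blueA _ _ (pq _ p1) (pq _ p2) r12; lra.
have pairBC o1 o2 : in_zone Y o1 -> in_zone Y o2 ->
    1 <= y o1 o2 + (B o1 + C o1) + (B o2 + C o2).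
  move=> p1 p2; have := (nC o1, nC o2); have := (nB o1, nB o2) => -[? ?] [? ?].
  have [r12|r12] := boolP (red o1 o2); last by have := blueC _ _ p1 p2 r12; lra.
  by have := redB _ _ (pY _ p1) (pY _ p2) r12; lra.
split=> /=; split.
- have : 3 <= 3 * mean2 X X y + 3 * mean2 X Y y + 3 * mean2 X Y y
      + (mean X A + mean X A + mean Y (fun o => 3 * A o + 12 / 5 * B o)).
    by apply: mean3_ge => o1 o2 o3 h1 h2 h3; have [+ _] := capped _ _ _ h1 h2 h3; clear; lra.
  by rewrite ?(meanD, meanZ, mean_cst); clear; lra.
- have : 50 / 13 <= 2 * mean2 X X y + 3 * mean2 X Y y + 3 * mean2 X Y y
      + (mean X (fun o => A o + B o) + mean X (fun o => A o + B o) + mean Y (fun o => 3 * A o + 3 * B o)).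
    by apply: mean3_ge => o1 o2 o3 h1 h2 h3; have [_ +] := capped _ _ _ h1 h2 h3; clear; lra.
  by rewrite ?(meanD, meanZ, mean_cst); clear; lra.
- have : 1 <= 1 * mean2 X X y + 1 * mean2 X Y y + 1 * mean2 X Y y
      + (mean X A + mean X A + mean Y A).
    by apply: mean3_ge => o1 o2 o3 h1 h2 h3; have := triA _ _ _ (qX _ h1) (qX _ h2) (qY _ h3); clear; lra.
  by rewrite ?(meanD, meanZ, mean_cst); clear; lra.
- have : 1 <= 1 * mean2 X Y y + 1 * mean2 X Y y + 1 * mean2 Y Y y
      + (mean X A + mean Y A + mean Y A).
    by apply: mean3_ge => o1 o2 o3 h1 h2 h3; have := triA _ _ _ (qX _ h1) (qY _ h2) (qY _ h3); clear; lra.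
  by rewrite ?(meanD, meanZ, mean_cst); clear; lra.
- have : 1 <= 1 * mean2 Y Y y + 1 * mean2 Y Y y + 1 * mean2 Y Y y
      + (mean Y A + mean Y A + mean Y A).
    by apply: mean3_ge => o1 o2 o3 h1 h2 h3; have := triA _ _ _ (qY _ h1) (qY _ h2) (qY _ h3); clear; lra.
  by rewrite ?(meanD, meanZ, mean_cst); clear; lra.
- have : 1 <= 1 * mean2 Y Y y + 1 * mean2 Y Z y + 1 * mean2 Y Z y
      + (mean Y A + mean Y A + mean Z A).
    by apply: mean3_ge => o1 o2 o3 h1 h2 h3; have := triA _ _ _ (qY _ h1) (qY _ h2) (qZ _ h3); clear; lra.
  by rewrite ?(meanD, meanZ, mean_cst); clear; lra.
- have : 1 <= 1 * mean2 X X y + 1 * mean2 X X y + 1 * mean2 X X y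
      + (mean X B + mean X B + mean X B).
    by apply: mean3_ge => o1 o2 o3 h1 h2 h3; have := triB _ _ _ (pX _ h1) (pX _ h2) (pX _ h3); clear; lra.
  by rewrite ?(meanD, meanZ, mean_cst); clear; lra.
- have : 2 <= 1 * mean2 X X y + 1 * mean2 X X y + 1 * mean2 X X y
      + (mean X (fun o => A o + B o) + mean X (fun o => A o + B o) + mean X (fun o => A o + B o)).
    by apply: mean3_ge => o1 o2 o3 h1 h2 h3; have := triAB _ _ _ (pX _ h1) (pX _ h2) (pX _ h3); clear; lra.
  by rewrite ?(meanD, meanZ, mean_cst); clear; lra.
- have : 2 <= 1 * mean2 X Y y + 1 * mean2 X Y y + 1 * mean2 Y Y y
      + (mean X (fun o => A o + B o) + mean Y (fun o => A o + B o) + mean Y (fun o => A o + B o)).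
    by apply: mean3_ge => o1 o2 o3 h1 h2 h3; have := triAB _ _ _ (pX _ h1) (pY _ h2) (pY _ h3); clear; lra.
  by rewrite ?(meanD, meanZ, mean_cst); clear; lra.
- have : 1 <= 1 * mean2 Y Y y + 1 * mean2 Y Y y + 1 * mean2 Y Y y
      + (mean Y C + mean Y C + mean Y C).
    by apply: mean3_ge => o1 o2 o3 h1 h2 h3; have := triC _ _ _ h1 h2 h3; clear; lra.
  by rewrite ?(meanD, meanZ, mean_cst); clear; lra.
(* An inequality on two points, with an idle third point of coefficient 0. *)
- have : 1 <= 1 * mean2 X Y y + 0 * mean2 X Y y + 0 * mean2 Y Y y
      + (mean X (fun o => A o + B o) + mean Y (fun o => A o + B o) + mean Y (fun=> 0)).
    by apply: mean3_ge => o1 o2 o3 h1 h2 h3; have := pairAB _ _ (pX _ h1) (pY _ h2); clear; lra.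
  by rewrite ?(meanD, meanZ, mean_cst); clear; lra.
- have : 1 <= 1 * mean2 Y Y y + 0 * mean2 Y Y y + 0 * mean2 Y Y y
      + (mean Y (fun o => B o + C o) + mean Y (fun o => B o + C o) + mean Y (fun=> 0)).
    by apply: mean3_ge => o1 o2 o3 h1 h2 h3; have := pairBC _ _ h1 h2; clear; lra.
  by rewrite ?(meanD, meanZ, mean_cst); clear; lra.
Qed.

(** A degree bound valid at each vertex of a zone passes to the mean over that zone, and these means
    are what [certificate] uses. Empty zones enter with size 0. *)
Lemma zone_bound (R : realFieldType) (I : finType) (y : I -> I -> R)
    (red : I -> I -> bool) (A B C : I -> R) (X Y Z : {set I}) (M : R) :
    zone_axioms y red A B C [in X] [in Y] [in Z] -> 0 <= M ->
    (forall t, [|| t \in X, t \in Y | t \in Z] ->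
      \sum_(i in X) y t i + \sum_(i in Y) y t i + \sum_(i in Z) y t i <= M) ->
  #|X|%:R + #|Y|%:R + #|Z|%:R <=
    \sum_(i in X) (13 / 7 * A i + B i + C i)
    + \sum_(i in Y) (13 / 7 * A i + B i + C i)
    + \sum_(i in Z) (13 / 7 * A i + B i + C i) + 15 / 7 * M.
Proof.
move=> ax M0 ubM; have axl := zone_axioms_lift ax.
have [[y0 ABC0 ysym _] _ _ _] := axl.
set yl := lift2 1 y in axl y0 ysym.
set A' := oapp A 0 in axl ABC0; set B' := oapp B 0 in axl ABC0.
set C' := oapp C 0 in axl ABC0.
have ge0 (f : option I -> R) (W : {set I}) : (forall o, 0 <= f o) -> 0 <= mean W f.
  by move=> f0; rewrite -(mean_cst W 0); apply: le_mean.
have ge02 (V W : {set I}) : 0 <= mean2 V W yl by apply: (ge0) => o; exact: ge0.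
have sym2 (V W : {set I}) : mean2 V W yl = mean2 W V yl.
  by rewrite /mean2 mean_exchange; apply: eq_mean => o; apply: eq_mean => o'.
pose P := Profile (mean2 X X yl) (mean2 X Y yl) (mean2 X Z yl)
    (mean2 Y Y yl) (mean2 Y Z yl) (mean2 Z Z yl) (mean X A') (mean Y A') (mean Z A')
    (mean X B') (mean Y B') (mean Z B') (mean X C') (mean Y C') (mean Z C').
have load (W : {set I}) : (forall i, i \in W -> [|| i \in X, i \in Y | i \in Z]) ->
    0 < (#|W|%:R : R) ->
    #|X|%:R * mean2 W X yl + #|Y|%:R * mean2 W Y yl + #|Z|%:R * mean2 W Z yl <= M.
  move=> sW W0; rewrite -!meanZ -!meanD; apply: mean_le_cst.
    by rewrite -card_gt0 -(ltr0n R).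
  by move=> t Wt; rewrite -!mean_sum; exact: ubM (sW t Wt).
have split_sum (W : {set I}) : \sum_(i in W) (13 / 7 * A i + B i + C i)
    = #|W|%:R * (13 / 7 * mean W A' + mean W B' + mean W C').
  by rewrite -meanZ -!meanD -mean_sum.
rewrite !split_sum; apply: (@certificate _ P) => //=.
- by split; split; do ?split; first [exact: ge02|apply: ge0 => o; case: (ABC0 o)].
- exact: zone_half_system axl.
- have := zone_half_system (zone_axioms_swap axl).
  by rewrite /half_system /= (sym2 Z Y).
- by move=> X0; apply: load X0 => i ->.
- by rewrite (sym2 X Y) => Y0; apply: load Y0 => i ->; rewrite orbT.
- by rewrite (sym2 X Z) (sym2 Y Z) => Z0; apply: load Z0 => i ->; rewrite !orbT.
Qed.

(** * Covers with a triangle of weight zero *)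

Definition fractional_cover (R : realFieldType) n (c : colouring n) (S : {set 'I_n})
    (y : {set 'I_n} -> R) : Prop :=
  (forall e, 0 <= y e) /\
  (forall u v w, u \in S -> v \in S -> w \in S -> u != v -> u != w -> v != w ->
    c [set u; v] = c [set u; w] -> c [set u; w] = c [set v; w] ->
    1 <= y [set u; v] + y [set u; w] + y [set v; w]).

Definition degree (R : realFieldType) n (S : {set 'I_n}) (y : {set 'I_n} -> R) v : R :=
  \sum_(u in S | u != v) y [set u; v].

(** Here [v1] is the vertex with two triangle edges of one colour, called red. A vertex with
    [s z >= 1] pays its unit by itself. For the others, collected in [Q], the triangles with two of
    [v1], [v2], [v3] force a blue edge to [v1] and a red one to [v2] or [v3]; [zone_bound] makes
    them pay jointly. *)
Lemma zero_cherry_bound (R : realFieldType) n (c : colouring n) (S : {set 'I_n})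
    (y : {set 'I_n} -> R) (D : R) (v1 v2 v3 : 'I_n) :
    fractional_cover c S y ->
    (forall v, v \in S -> degree S y v <= D) ->
    [/\ v1 \in S, v2 \in S & v3 \in S] -> [/\ v1 != v2, v1 != v3 & v2 != v3] ->
    [/\ y [set v1; v2] = 0, y [set v1; v3] = 0 & y [set v2; v3] = 0] ->
    c [set v1; v2] = c [set v1; v3] -> c [set v2; v3] != c [set v1; v2] ->
  #|S|%:R <= 6 * D + 6.
Proof.
move=> [y0 cov] degD [S1 S2 S3] [n12 n13 n23] [y12 y13 y23] c123 c23.
pose red i j := c [set i; j] == c [set v1; v2].
have redC i j : red i j = red j i by rewrite /red setUC.
pose A i := y [set i; v1]; pose B i := y [set i; v2]; pose C i := y [set i; v3].
pose s i := 13 / 7 * A i + B i + C i.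
pose T := S :\ v1 :\ v2 :\ v3.
have inT z : z \in T -> [/\ z \in S, z != v1, z != v2 & z != v3].
  by rewrite !inE => /and4P[-> -> -> ->].
pose Q := [set z in T | s z < 1].
have D0 : 0 <= D by apply: le_trans (degD _ S1); apply: sumr_ge0 => *; apply: y0.
have mono u v w : u \in S -> v \in S -> w \in S -> u != v -> u != w -> v != w ->
    red u v = red u w -> red u w = red v w ->
    1 <= y [set u; v] + y [set u; w] + y [set v; w].
  move=> Su Sv Sw uv uw vw e1 e2; apply: cov => //; move: e1 e2; rewrite /red;
  by case: (c [set u; v]); case: (c [set u; w]); case: (c [set v; w]); case: (c [set v1; v2]).
have big_s z : z \in T -> A z + B z + C z >= 1 -> 1 <= s z.
  by move=> _; have := y0 [set z; v1]; rewrite /s /A; lra.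
have QT z : z \in Q -> z \in T by rewrite inE => /andP[].
have Qs z : z \in Q -> s z < 1 by rewrite inE => /andP[].
have Qlt z : z \in Q -> A z + B z + C z < 1.
  by move=> zQ; rewrite ltNge; apply/negP => /(big_s _ (QT _ zQ)); rewrite leNgt Qs.
have r12 : red v1 v2 by rewrite /red eqxx.
have r13 : red v1 v3 by rewrite /red c123 eqxx.
have r23 : ~~ red v2 v3 by [].
have Qa z : z \in Q -> ~~ red z v1 /\ (red z v2 || red z v3).
  move=> zQ; have [zS z1 z2 z3] := inT _ (QT _ zQ); have := Qlt _ zQ.
  have A0 : 0 <= A z := y0 _.
  have B0 : 0 <= B z := y0 _.
  have C0 : 0 <= C z := y0 _.
  have b12 : red z v1 -> red z v2 -> 1 <= A z + B z.
    move=> h1 h2; have := @mono z v1 v2 zS S1 S2 z1 z2 n12.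
    by rewrite h1 h2 r12 y12 addr0 => /(_ erefl erefl).
  have b13 : red z v1 -> red z v3 -> 1 <= A z + C z.
    move=> h1 h2; have := @mono z v1 v3 zS S1 S3 z1 z3 n13.
    by rewrite h1 h2 r13 y13 addr0 => /(_ erefl erefl).
  have b23 : ~~ red z v2 -> ~~ red z v3 -> 1 <= B z + C z.
    move=> h1 h2; have := @mono z v2 v3 zS S2 S3 z2 z3 n23.
    by rewrite (negPf h1) (negPf h2) (negPf r23) y23 addr0 => /(_ erefl erefl).
  move: (A z) (B z) (C z) A0 B0 C0 b12 b13 b23 => p q r p0 q0 r0 b12 b13 b23 lt1.
  split; first apply/negP => h1.
    have [h2|h2] := boolP (red z v2); first by have := b12 h1 h2; lra.
    have [h3|h3] := boolP (red z v3); first by have := b13 h1 h3; lra.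
    by have := b23 h2 h3; lra.
  by apply/negPn/negP => /norP[h2 h3]; have := b23 h2 h3; lra.
pose X := [set z in Q | red z v2 & red z v3].
pose Y := [set z in Q | red z v2 & ~~ red z v3].
pose Z := [set z in Q | ~~ red z v2].
have inX z : z \in X -> [/\ z \in Q, red z v2 & red z v3] by rewrite inE => /and3P[].
have inY z : z \in Y -> [/\ z \in Q, red z v2 & ~~ red z v3] by rewrite inE => /and3P[].
have inZ z : z \in Z -> [/\ z \in Q, ~~ red z v2 & red z v3].
  rewrite inE => /andP[zQ h2]; split => //.
  by have [_] := Qa _ zQ; rewrite (negPf h2).
have sumQ (F : 'I_n -> R) : \sum_(i in Q) F i
    = \sum_(i in X) F i + \sum_(i in Y) F i + \sum_(i in Z) F i.
  rewrite (bigID (fun i => red i v2)) /=; congr (_ + _).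
    rewrite (bigID (fun i => red i v3)) /=.
    by congr (_ + _); apply: eq_bigl => i; rewrite [RHS]inE -andbA.
  by apply: eq_bigl => i; rewrite [RHS]inE.
(* The value 1 on the diagonal keeps the covering inequalities true for repeated points; it raises
   the load of a test vertex from [D] to [D + 1]. *)
pose yd i j := if i == j then 1 else y [set i; j].
have inQ z : [|| z \in X, z \in Y | z \in Z] -> z \in Q.
  by case/or3P => [/inX[]|/inY[]|/inZ[]].
have yd0 i j : 0 <= yd i j by rewrite /yd; case: eqP.
have via v i j : v \in S -> i \in T -> j \in T -> i != v -> j != v ->
    red i v = red i j -> red j v = red i j -> 1 <= yd i j + y [set i; v] + y [set j; v].
  move=> Sv Ti Tj iv jv e1 e2; rewrite /yd; case: eqP => [ij|/eqP ij].
    by rewrite -addrA lerDl addr_ge0.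
  have [Si _ _ _] := inT _ Ti; have [Sj _ _ _] := inT _ Tj.
  by apply: mono => //; rewrite ?e1 ?e2.
have ax : zone_axioms yd red A B C [in X] [in Y] [in Z].
  split.
  - split=> //.
    + by move=> i; split; exact: y0.
    + by move=> i j; rewrite /yd eq_sym setUC.
    + by move=> i /inQ /Qs /ltW.
  - move=> i j /inQ iQ /inQ jQ r; have [_ i1 i2 i3] := inT _ (QT _ iQ).
    have [_ j1 j2 j3] := inT _ (QT _ jQ).
    have [ri _] := Qa _ iQ; have [rj _] := Qa _ jQ.
    by apply: via => //; rewrite ?QT // ?(negPf r) ?(negPf ri) ?(negPf rj).
  - split=> i j.
    + move=> qi qj r; have [iQ ri] : i \in Q /\ red i v2.
        by case/orP: qi => [/inX[]|/inY[]].
      have [jQ rj] : j \in Q /\ red j v2 by case/orP: qj => [/inX[]|/inY[]].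
      have [_ i1 i2 i3] := inT _ (QT _ iQ); have [_ j1 j2 j3] := inT _ (QT _ jQ).
      by apply: via => //; rewrite ?QT // ?r ?ri ?rj.
    + move=> qi qj r; have [iQ ri] : i \in Q /\ red i v3.
        by case/orP: qi => [/inX[]|/inZ[]].
      have [jQ rj] : j \in Q /\ red j v3 by case/orP: qj => [/inX[]|/inZ[]].
      have [_ i1 i2 i3] := inT _ (QT _ iQ); have [_ j1 j2 j3] := inT _ (QT _ jQ).
      by apply: via => //; rewrite ?QT // ?r ?ri ?rj.
    + move=> /inY[iQ _ ri] /inY[jQ _ rj] r.
      have [_ i1 i2 i3] := inT _ (QT _ iQ); have [_ j1 j2 j3] := inT _ (QT _ jQ).
      by apply: via => //; rewrite ?QT // ?(negPf r) ?(negPf ri) ?(negPf rj).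
    + move=> /inZ[iQ ri _] /inZ[jQ rj _] r.
      have [_ i1 i2 i3] := inT _ (QT _ iQ); have [_ j1 j2 j3] := inT _ (QT _ jQ).
      by apply: via => //; rewrite ?QT // ?(negPf r) ?(negPf ri) ?(negPf rj).
  - move=> i j k /inQ iQ /inQ jQ /inQ kQ e1 e2.
    have := (yd0 i j, yd0 i k, yd0 j k) => -[[ij0 ik0] jk0].
    have [Si _ _ _] := inT _ (QT _ iQ); have [Sj _ _ _] := inT _ (QT _ jQ).
    have [Sk _ _ _] := inT _ (QT _ kQ).
    have yd1 z : yd z z = 1 by rewrite /yd eqxx.
    have [ij|ij] := eqVneq i j.
      by rewrite -ij yd1 -addrA lerDl addr_ge0.
    have [ik|ik] := eqVneq i k.
      by rewrite -ik yd1 addrAC lerDr addr_ge0.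
    have [jk|jk] := eqVneq j k.
      by rewrite -jk yd1 lerDr addr_ge0.
    by rewrite /yd (negPf ij) (negPf ik) (negPf jk); exact: mono.
have TS z : z \in T -> z \in S by move=> /inT[].
have degS v (W : {set 'I_n}) : v \in S -> (forall z, z \in W -> z \in S) ->
    \sum_(i in W | i != v) y [set i; v] <= D.
  move=> Sv WS; apply: le_trans (degD _ Sv); rewrite /degree.
  rewrite [leRHS](bigID (fun i => i \in W)) /= -[leLHS]addr0; apply: lerD.
    rewrite le_eqVlt; apply/orP; left; apply/eqP; apply: eq_bigl => i.
    by case iW : (i \in W); rewrite ?andbF // (WS _ iW) andbT.
  by apply: sumr_ge0 => *; exact: y0.
have load t : [|| t \in X, t \in Y | t \in Z] ->
    \sum_(i in X) yd t i + \sum_(i in Y) yd t i + \sum_(i in Z) yd t i <= D + 1.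
  move=> /inQ tQ; rewrite -sumQ (bigD1 t) //= /yd eqxx addrC lerD2r.
  have tS := TS _ (QT _ tQ); apply: le_trans (degS t Q tS _); last by move=> z /QT /TS.
  rewrite le_eqVlt; apply/orP; left; apply/eqP; apply: eq_bigr => i /andP[_ it].
  by rewrite eq_sym (negPf it) setUC.
have := zone_bound ax (addr_ge0 D0 ler01) load.
have cardQ : #|X|%:R + #|Y|%:R + #|Z|%:R = #|Q|%:R :> R.
  by have := sumQ (fun=> 1); rewrite !sumr_const.
rewrite cardQ -sumQ => le1.
have degT v (F : 'I_n -> R) : v \in S -> (forall z, z \in T -> z != v) ->
    F =1 (fun z => y [set z; v]) -> \sum_(z in T) F z <= D.
  move=> Sv Tv FE; apply: le_trans (degS v T Sv TS).
  rewrite le_eqVlt; apply/orP; left; apply/eqP.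
  rewrite [RHS](eq_bigl [in T]); last by move=> i /=; case iT : (i \in T); rewrite //= Tv.
  by apply: eq_bigr => i _; exact: FE.
have dA : \sum_(z in T) A z <= D by apply: (degT v1) => // z /inT[].
have dB : \sum_(z in T) B z <= D by apply: (degT v2) => // z /inT[].
have dC : \sum_(z in T) C z <= D by apply: (degT v3) => // z /inT[].
have sT : \sum_(z in T) s z <= 13 / 7 * D + D + D.
  by rewrite /s !big_split /= -mulr_sumr; move: dA dB dC; clear; lra.
have cardT : #|T|%:R <= \sum_(z in T) s z + 15 / 7 * (D + 1) :> R.
  rewrite -(cardsID Q T) (setIidPr _) ?natrD; last by apply/subsetP => z /QT.
  rewrite (big_setID Q) /= (setIidPr _); last by apply/subsetP => z /QT.
  have : #|T :\: Q|%:R <= \sum_(z in T :\: Q) s z :> R.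
    rewrite -sumr_const; apply: ler_sum => z; rewrite inE => /andP[zQ zT].
    by move: zQ; rewrite inE zT /= -leNgt.
  by move: le1; clear; lra.
(* So far [#|T|] is at most [6 * D + 15 / 7]; with the three triangle vertices this stays below
   [6 * D + 6]. *)
have : #|S|%:R <= #|T|%:R + 3 :> R.
  rewrite -[3]/(3%:R) -natrD ler_nat /T (cardsD1 v1 S) S1 (cardsD1 v2 (S :\ v1)).
  rewrite (cardsD1 v3 (S :\ v1 :\ v2)).
  rewrite addnA (addnC #|_|) addnA leq_add2r.
  by case: (v2 \in _); case: (v3 \in _).
by move: cardT sT D0; clear; lra.
Qed.

(** Weight zero excludes a monochromatic triangle, so exactly one of its vertices has two triangle
    edges of the same colour; the cases decide which one plays [v1]. *)
Lemma zero_triangle_bound (R : realFieldType) n (c : colouring n) (S : {set 'I_n})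
    (y : {set 'I_n} -> R) (D : R) (v1 v2 v3 : 'I_n) :
    fractional_cover c S y ->
    (forall v, v \in S -> degree S y v <= D) ->
    [/\ v1 \in S, v2 \in S & v3 \in S] -> [/\ v1 != v2, v1 != v3 & v2 != v3] ->
    [/\ y [set v1; v2] = 0, y [set v1; v3] = 0 & y [set v2; v3] = 0] ->
  #|S|%:R <= 6 * D + 6.
Proof.
move=> cov degD [S1 S2 S3] [n12 n13 n23] [y12 y13 y23].
have notmono : ~ (c [set v1; v2] = c [set v1; v3] /\ c [set v1; v3] = c [set v2; v3]).
  case=> e1 e2; have [_ /(_ v1 v2 v3 S1 S2 S3 n12 n13 n23 e1 e2)] := cov.
  by rewrite y12 y13 y23 !addr0 ler10.
have [e1|e1] := eqVneq (c [set v1; v2]) (c [set v1; v3]).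
  apply: (zero_cherry_bound cov degD (And3 S1 S2 S3) (And3 n12 n13 n23)) => //.
  by apply/eqP => e2; apply: notmono; rewrite -e1.
have [e2|e2] := eqVneq (c [set v1; v2]) (c [set v2; v3]).
  apply: (zero_cherry_bound cov degD (And3 S2 S1 S3)); rewrite ?[[set v2; v1]]setUC //.
    by rewrite eq_sym.
  by rewrite eq_sym.
apply: (zero_cherry_bound cov degD (And3 S3 S1 S2)); rewrite ?[[set v3; _]]setUC //.
- by rewrite ![v3 == _]eq_sym.
- by case: (c [set v1; v2]) (c [set v1; v3]) (c [set v2; v3]) e1 e2 => [] [] [].
Qed.

(** * Mantel's theorem *)

(** Adjacent vertices have disjoint neighbourhoods, so their degrees sum to at most [#|S|]. Summing
    over ordered adjacent pairs bounds the sum of squared degrees, and Cauchy-Schwarz finishes. *)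
Lemma mantel (T : finType) (S : {set T}) (adj : rel T) :
    symmetric adj ->
    (forall u v w, u \in S -> v \in S -> w \in S -> adj u v -> adj u w -> ~~ adj v w) ->
  (2 * \sum_(u in S) #|[set v in S | adj u v]| <= #|S| ^ 2)%N.
Proof.
move=> adjC tf; pose N u := [set v in S | adj u v].
have pair u v : u \in S -> v \in N u -> (#|N u| + #|N v| <= #|S|)%N.
  move=> Su; rewrite inE => /andP[Sv uv]; rewrite -cardsUI.
  have /eqP -> : #|N u :&: N v| == 0%N.
    rewrite cards_eq0; apply/set0Pn => -[w]; rewrite !inE => /andP[/andP[Sw uw] /andP[_ vw]].
    by move: (tf u v w Su Sv Sw uv uw); rewrite vw.
  by rewrite addn0; apply/subset_leq_card/subsetP => w; rewrite !inE => /orP[] /andP[].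
have swap (F : T -> nat) :
    (\sum_(u in S) \sum_(v in N u) F v = \sum_(v in S) #|N v| * F v)%N.
  transitivity (\sum_(u in S) \sum_(v in S) (if adj u v then F v else 0))%N.
    apply: eq_bigr => u _; rewrite -big_mkcondr; apply: eq_bigl => v.
    by rewrite inE.
  rewrite exchange_big; apply: eq_bigr => v _; rewrite -big_mkcondr /=.
  rewrite sum_nat_cond_const; congr (_ * _)%N; apply: eq_card => u.
  by rewrite !inE /in_mem /= adjC.
have sq : (2 * \sum_(u in S) #|N u| * #|N u| <= #|S| * \sum_(u in S) #|N u|)%N.
  have -> : (2 * \sum_(u in S) #|N u| * #|N u|
      = \sum_(u in S) \sum_(v in N u) (#|N u| + #|N v|))%N.
    rewrite mul2n -addnn -{2}swap -big_split; apply: eq_bigr => u _.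
    by rewrite big_split sum_nat_const.
  rewrite big_distrr; apply: leq_sum => u Su.
  by rewrite /= mulnC -sum_nat_const; apply: leq_sum => v; exact: pair.
have cs : ((\sum_(u in S) #|N u|) ^ 2 <= #|S| * \sum_(u in S) #|N u| * #|N u|)%N.
  rewrite -(leq_pmul2l (isT : 0 < 2)%N).
  have -> : (2 * (\sum_(u in S) #|N u|) ^ 2
      = \sum_(u in S) \sum_(v in S) 2 * (#|N u| * #|N v|))%N.
    rewrite -mulnn big_distrl /= big_distrr; apply: eq_bigr => u _.
    by rewrite /= big_distrr /= big_distrr.
  have -> : (2 * (#|S| * \sum_(u in S) #|N u| * #|N u|)
      = \sum_(u in S) \sum_(v in S) (#|N u| ^ 2 + #|N v| ^ 2))%N.
    under [RHS]eq_bigr do rewrite big_split /= sum_nat_const.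
    rewrite big_split /= -big_distrr /= sum_nat_const mul2n -addnn.
    by congr (_ + _)%N; congr (_ * _)%N; apply: eq_bigr => u _; rewrite mulnn.
  by apply: leq_sum => u _; apply: leq_sum => v _; exact: nat_Cauchy.
rewrite -/N; set d := (\sum_(u in S) #|N u|)%N in sq cs *.
have [->//|d_gt0] := posnP d.
rewrite -(leq_pmul2r d_gt0) -mulnA mulnn; apply: leq_trans (leq_mul (leqnn 2) cs) _.
by rewrite mulnCA -mulnn -mulnA leq_mul.
Qed.

(** * Linear programming duality *)

Lemma between (R : realFieldType) (K : finType) (P Q : pred K) (f g : K -> R) :
    (forall i j, P i -> Q j -> f i <= g j) ->
  exists t, (forall i, P i -> f i <= t) /\ (forall j, Q j -> t <= g j).
Proof.
move=> fg; have [/existsP[i0 Pi0]|/existsPn noP] := boolP [exists i, P i].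
  case: (arg_maxP f Pi0) => i Pi fi; exists (f i); split=> [k Pk|j Qj]; first exact: fi.
  exact: fg.
have [/existsP[j0 Qj0]|/existsPn noQ] := boolP [exists i, Q i].
  case: (arg_minP g Qj0) => j Qj gj; exists (g j); split=> [k Pk|k Qk]; last exact: gj.
  by have := noP k; rewrite Pk.
by exists 0; split=> k Pk; [have := noP k|have := noQ k]; rewrite Pk.
Qed.

(* One step of Fourier-Motzkin elimination: the derived inequalities are indexed
   by pairs, a pair [(i, j)] with coefficients of opposite signs at [x] standing
   for the combination that cancels [x]. *)
Lemma farkas_seq (R : realFieldType) (V : finType) (s : seq V) :
  forall (K : finType) (a : K -> V -> R) (b : K -> R),
    (forall k x, x \notin s -> a k x = 0) ->
  (exists x : V -> R, forall k, \sum_v a k v * x v <= b k) \/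
  (exists u : K -> R, [/\ forall k, 0 <= u k, forall v, \sum_k u k * a k v = 0 &
                          \sum_k u k * b k < 0]).
Proof.
elim: s => [|x s IHs] K a b supp.
  have [/forallP b0|] := boolP [forall k, 0 <= b k].
    by left; exists (fun=> 0) => k; rewrite big1 // => v _; rewrite mulr0.
  rewrite negb_forall => /existsP[k]; rewrite -ltNge => bk.
  right; exists (fun i => (i == k)%:R); split=> [i|v|].
  - exact: ler0n.
  - by rewrite big1 // => i _; rewrite supp ?mulr0.
  - rewrite (bigD1 k) //= eqxx mul1r big1 ?addr0 // => i /negPf->.
    by rewrite mul0r.
(* Multipliers of the derived inequality [p]: the combination that cancels [x] if the signs are
   positive and negative, a copy of inequality [p.1] if [x] does not occur in it, and the void
   inequality otherwise. *)
pose cf (p : K * K) (k : K) : R :=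
  if (0 < a p.1 x) && (a p.2 x < 0) then (k == p.1)%:R * - a p.2 x + (k == p.2)%:R * a p.1 x
  else if a p.1 x == 0 then (k == p.1)%:R else 0.
have cf0 p k : 0 <= cf p k.
  rewrite /cf; case: ifP => [/andP[p1 p2]|_]; last by case: ifP => // _; exact: ler0n.
  by rewrite addr_ge0 // mulr_ge0 ?ler0n // ?oppr_ge0 ltW.
pose a' p v := \sum_k cf p k * a k v; pose b' p := \sum_k cf p k * b k.
have sum_cf (F : K -> R) p : \sum_k cf p k * F k =
    if (0 < a p.1 x) && (a p.2 x < 0) then - a p.2 x * F p.1 + a p.1 x * F p.2
    else if a p.1 x == 0 then F p.1 else 0.
  have one (k0 : K) (z : R) : \sum_k (k == k0)%:R * z * F k = z * F k0.
    rewrite (bigD1 k0) //= eqxx mul1r big1 ?addr0 // => k /negPf->.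
    by rewrite !mul0r.
  rewrite /cf; case: ifP => _.
    by under eq_bigr do rewrite mulrDl; rewrite big_split !one.
  case: ifP => _; last by rewrite big1 // => k _; rewrite mul0r.
  by rewrite -[RHS]mul1r -one; apply: eq_bigr => k _; rewrite mulr1.
have supp' p v : v \notin s -> a' p v = 0.
  move=> vs; rewrite /a' sum_cf.
  have [->|vx] := eqVneq v x; last first.
    have av k : a k v = 0 by apply: supp; rewrite inE negb_or vx.
    by rewrite !av !mulr0 addr0; do 2?case: ifP.
  case: ifP => [_|_]; last by case: eqP.
  by rewrite mulNr mulrC addNr.
have [[z zP]|[u [u0 ua ub]]] := IHs _ a' b' supp'; last first.
  right; exists (fun k => \sum_p u p * cf p k); split=> [k|v|].
  - by apply: sumr_ge0 => p _; rewrite mulr_ge0.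
  - rewrite -[RHS](ua v) /a'; under eq_bigr do rewrite mulr_suml.
    rewrite exchange_big; apply: eq_bigr => p _; rewrite mulr_sumr.
    by apply: eq_bigr => k _; rewrite mulrA.
  - apply: le_lt_trans ub; rewrite le_eqVlt; apply/orP; left; apply/eqP.
    rewrite /b'; under eq_bigr do rewrite mulr_suml.
    rewrite exchange_big; apply: eq_bigr => p _; rewrite mulr_sumr.
    by apply: eq_bigr => k _; rewrite mulrA.
left.
pose r k := b k - \sum_(v | v != x) a k v * z v.
have zP' p : \sum_k cf p k * (\sum_v a k v * z v) <= \sum_k cf p k * b k.
  apply: le_trans (zP p); rewrite le_eqVlt; apply/orP; left; apply/eqP.
  rewrite /a'; under [RHS]eq_bigr do rewrite mulr_suml.
  rewrite exchange_big; apply: eq_bigr => k _; rewrite mulr_sumr.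
  by apply: eq_bigr => v _; rewrite mulrA.
have rE k : b k - \sum_v a k v * z v = r k - a k x * z x.
  by rewrite /r (bigD1 x) //= opprD addrA addrAC.
have cmp i j : 0 < a i x -> a j x < 0 -> r j / a j x <= r i / a i x.
  move=> i0 j0; have := zP' (i, j); rewrite !sum_cf /= i0 j0 /= -subr_ge0.
  have -> : - a j x * b i + a i x * b j
     - (- a j x * (\sum_v a i v * z v) + a i x * (\sum_v a j v * z v))
     = - a j x * (b i - \sum_v a i v * z v) + a i x * (b j - \sum_v a j v * z v) by ring.
  rewrite !rE => h; rewrite ler_ndivrMr // mulrAC ler_pdivrMr //.
  by rewrite -subr_ge0; apply: le_trans h _; rewrite le_eqVlt; apply/orP; left; apply/eqP; ring.
have zero k : a k x = 0 -> 0 <= r k.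
  move=> k0; have := zP' (k, k); rewrite !sum_cf /= k0 ltxx eqxx /= -subr_ge0 rE k0.
  by rewrite mul0r subr0.
suff [t tP] : exists t, forall k, a k x * t <= r k.
  exists (fun v => if v == x then t else z v) => k.
  rewrite (bigD1 x) //= eqxx -lerBrDr; apply: le_trans (tP k) _.
  rewrite le_eqVlt; apply/orP; left; apply/eqP; congr (_ - _).
  by apply: eq_bigr => v /negPf->.
(* Back substitution: negative coefficients bound the eliminated variable from below, positive ones
   from above, and [cmp] says that these bounds are compatible. *)
suff [t [tl tu]] : exists t, (forall k, a k x < 0 -> r k / a k x <= t) /\
    (forall k, 0 < a k x -> t <= r k / a k x).
  exists t => k; have [k0|k0|k0] := ltrgt0P (a k x).
  - by rewrite mulrC -ler_pdivlMr //; exact: tu.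
  - by rewrite mulrC -ler_ndivrMr //; exact: tl.
  - by rewrite k0 mul0r; exact: zero.
apply: (@between _ _ (fun k => a k x < 0) (fun k => 0 < a k x)
  (fun k => r k / a k x) (fun k => r k / a k x)) => j i j0 i0; exact: cmp.
Qed.

(** Feasibility of both programs and the inequality between their values opposite to weak duality
    form a single system in the joint unknowns [(y, w)], to which [farkas_seq] applies. [pos] says
    that each requirement can be met, so that the cover exists. *)
Lemma lp_duality (R : realFieldType) (X T : finType) (a : T -> X -> R) (b : T -> R) :
    (forall t x, 0 <= a t x) -> (forall t, 0 <= b t) ->
    (forall t, 0 < b t -> exists x, 0 < a t x) ->
  exists (y : X -> R) (w : T -> R),
    [/\ forall x, 0 <= y x, forall t, 0 <= w t,
        forall t, b t <= \sum_x a t x * y x,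
        forall x, \sum_t a t x * w t <= 1 & \sum_x y x = \sum_t b t * w t].
Proof.
move=> a0 b0 pos.
pose V : finType := (X + T)%type; pose K : finType := (V + V + unit)%type.
pose A (k : K) (v : V) : R :=
  match k, v with
  | inl (inl k'), _ => - (k' == v)%:R
  | inl (inr (inl x)), inr t => a t x
  | inl (inr (inr t)), inl x => - a t x
  | inr _, inl _ => 1
  | inr _, inr t => - b t
  | _, _ => 0
  end.
pose B (k : K) : R :=
  match k with inl (inr (inl _)) => 1 | inl (inr (inr t)) => - b t | _ => 0 end.
have split_unit (F : unit -> R) : \sum_u F u = F tt.
  by rewrite (bigD1 tt) //= big1 ?addr0 // => -[].
have delta (k0 : V) (z : V -> R) : \sum_v z v * - (v == k0)%:R = - z k0.
  rewrite (bigD1 k0) //= eqxx mulrN1 big1 ?addr0 // => v /negPf->.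
  by rewrite oppr0 mulr0.
have sumK (F : K -> R) : \sum_k F k = \sum_v F (inl (inl v))
    + (\sum_x F (inl (inr (inl x))) + \sum_t F (inl (inr (inr t)))) + F (inr tt).
  by rewrite big_sumType /= split_unit big_sumType /= [X in _ + X + _]big_sumType.
have sumV (F : V -> R) : \sum_v F v = \sum_x F (inl x) + \sum_t F (inr t).
  by rewrite big_sumType.
have [|[z zP]|[u [u0 uA uB]]] := @farkas_seq R V (enum V) K A B.
- by move=> k v; rewrite mem_enum.
- have z0 v : 0 <= z v.
    have := zP (inl (inl v)); rewrite -[\sum_v _]/(\sum_v0 - (v == v0)%:R * z v0) /=.
    under eq_bigr do rewrite mulrC eq_sym.
    by rewrite delta oppr_le0.
  pose y x := z (inl x); pose w t := z (inr t).
  have pack x : \sum_t a t x * w t <= 1.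
    by have := zP (inl (inr (inl x))); rewrite sumV /= big1 ?add0r // => *; rewrite mul0r.
  have cover t : b t <= \sum_x a t x * y x.
    have := zP (inl (inr (inr t))); rewrite sumV /= [X in _ + X]big1 ?addr0; last first.
      by move=> *; rewrite mul0r.
    by under eq_bigr do rewrite mulNr; rewrite sumrN lerN2.
  exists y, w; split=> //; try by move=> *; exact: z0.
  apply/eqP; rewrite eq_le; apply/andP; split.
    have := zP (inr tt); rewrite sumV /=.
    under eq_bigr do rewrite mul1r.
    under [X in _ + X]eq_bigr do rewrite mulNr.
    by rewrite sumrN subr_le0.
  apply: (@le_trans _ _ (\sum_t \sum_x a t x * y x * w t)).
    by apply: ler_sum => t _; rewrite -mulr_suml ler_wpM2r // z0.
  rewrite exchange_big /=; apply: ler_sum => x _.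
  under eq_bigr do rewrite mulrAC.
  by rewrite -mulr_suml -[leRHS]mul1r ler_wpM2r // z0.
exfalso; pose q x := u (inl (inr (inl x))); pose p t := u (inl (inr (inr t))).
pose r := u (inr tt).
have pa x : \sum_t p t * a t x <= r.
  have := uA (inl x); rewrite sumK /= delta [\sum_x _]big1 ?add0r;
    last by move=> *; rewrite mulr0.
  under eq_bigr do rewrite mulrN.
  rewrite sumrN mulr1 -/r => h; have := u0 (inl (inl (inl x))).
  by move: h; rewrite /p; lra.
have qa t : r * b t <= \sum_x q x * a t x.
  have := uA (inr t); rewrite sumK /= delta [X in _ + (_ + X)]big1 ?addr0; last by move=> *; rewrite mulr0.
  rewrite mulrN -/r => h; have := u0 (inl (inl (inr t))).
  by move: h; rewrite /q; lra.
have lt_qp : \sum_x q x < \sum_t p t * b t.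
  move: uB; rewrite sumK /= [X in X + _ + _]big1; last by move=> *; rewrite mulr0.
  under eq_bigr do rewrite mulr1.
  under [X in _ + (_ + X)]eq_bigr do rewrite mulrN.
  by rewrite sumrN mulr0 add0r addr0 subr_lt0.
(* [r] is the multiplier of the row comparing the two values. If it is positive, [p] and [q] are
   scaled feasible solutions violating weak duality; otherwise [pa] and [pos] make [p] vanish
   wherever [b] is positive. *)
have [r0|r_le0] := ltP 0 r.
  have : r * \sum_t p t * b t <= r * \sum_x q x.
    apply: (@le_trans _ _ (\sum_t \sum_x p t * (q x * a t x))).
      rewrite mulr_sumr; apply: ler_sum => t _; rewrite mulrCA -mulr_sumr.
      by rewrite ler_wpM2l // u0.
    rewrite exchange_big mulr_sumr /=; apply: ler_sum => x _.
    under eq_bigr do rewrite mulrCA.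
    by rewrite -mulr_sumr mulrC ler_wpM2r // u0.
  by rewrite ler_pM2l // leNgt lt_qp.
have : 0 <= \sum_x q x by apply: sumr_ge0 => x _; exact: u0.
apply/negP; rewrite -ltNge; apply: lt_le_trans lt_qp _.
rewrite big1 // => t _; have [bt|] := ltP 0 (b t); last first.
  by move=> bt; have /eqP -> : b t == 0; rewrite ?mulr0 // eq_le bt b0.
have [x ax] := pos t bt; suff -> : p t = 0 by rewrite mul0r.
have : p t * a t x <= 0.
  apply: le_trans (le_trans (pa x) r_le0); rewrite (bigD1 t) //= lerDl.
  by apply: sumr_ge0 => t' _; rewrite mulr_ge0 // u0.
rewrite pmulr_lle0 // => pt; apply/eqP; rewrite eq_le pt; exact: u0.
Qed.

(** The products of [y] with the packing slack are nonnegative, and equality of the two values makes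
    their sum at most 0. *)
Lemma complementary_slackness (R : realFieldType) (X T : finType) (a : T -> X -> R)
    (b : T -> R) (y : X -> R) (w : T -> R) (x : X) :
    (forall x, 0 <= y x) -> (forall t, 0 <= w t) ->
    (forall t, b t <= \sum_x a t x * y x) -> (forall x, \sum_t a t x * w t <= 1) ->
    \sum_x y x = \sum_t b t * w t ->
  0 < y x -> \sum_t a t x * w t = 1.
Proof.
move=> y0 w0 cover pack eq_yw yx.
have slack0 z : 0 <= y z * (1 - \sum_t a t z * w t) by rewrite mulr_ge0 ?subr_ge0.
have : \sum_z y z * (1 - \sum_t a t z * w t) <= 0.
  under eq_bigr do rewrite mulrBr mulr1.
  rewrite sumrB eq_yw subr_le0.
  under [leRHS]eq_bigr do rewrite mulr_sumr.
  rewrite exchange_big; apply: ler_sum => t _ /=.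
  apply: le_trans (ler_wpM2r (w0 t) (cover t)) _; rewrite mulr_suml le_eqVlt.
  by apply/orP; left; apply/eqP/eq_bigr => z _; rewrite mulrAC mulrC.
rewrite (bigD1 x) //= => le0.
have : y x * (1 - \sum_t a t x * w t) <= 0.
  by apply: le_trans le0; rewrite lerDl sumr_ge0.
by rewrite pmulr_rle0 // subr_le0 => ge1; apply/eqP; rewrite eq_le pack.
Qed.

(** * Fractional packings and covers *)

Definition edges n (S : {set 'I_n}) : {set {set 'I_n}} :=
  [set e : {set 'I_n} | e \subset S & #|e| == 2].

Definition mono_triangles n (c : colouring n) (S : {set 'I_n}) : {set {set 'I_n}} :=
  [set T : {set 'I_n} | (T \subset S) && (triangle T && monochromatic c T)].

Definition fractional_packing (R : realFieldType) n (c : colouring n) (S : {set 'I_n})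
    (w : {set 'I_n} -> R) : Prop :=
  [/\ forall T, 0 <= w T, forall T, T \notin mono_triangles c S -> w T = 0 &
      forall e : {set 'I_n}, #|e| == 2 -> \sum_(T : {set 'I_n} | e \subset T) w T <= 1].

Lemma card_edges n (S : {set 'I_n}) : #|edges S| = 'C(#|S|, 2).
Proof. exact: cards_draws. Qed.

Lemma edges3 n (u v w : 'I_n) : u != v -> u != w -> v != w ->
  edges [set u; v; w] = [set [set u; v]; [set u; w]; [set v; w]].
Proof.
move=> uv uw vw; apply/esym/eqP; rewrite eqEcard; apply/andP; split.
  apply/subsetP => e; rewrite !inE => /orP[/orP[]|] /eqP->;
    by rewrite cards2 ?uv ?uw ?vw ?eqxx ?andbT; apply/subsetP => z; rewrite !inE;
       case/orP => ->; rewrite ?orbT.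
rewrite card_edges.
have -> : #|[set u; v; w]| = 3 
  by rewrite setUC cardsU1 cards2 uv !inE negb_or ![w == _]eq_sym uw vw.
have neq (e e' : {set 'I_n}) z : z \in e -> z \notin e' -> e != e'.
  by move=> ze; apply: contraNneq => <-.
have n1 : [set u; v] != [set u; w].
  by apply: (neq _ _ v); rewrite !inE ?eqxx ?orbT // negb_or eq_sym uv.
have n2 : [set v; w] != [set u; v].
  by apply: (neq _ _ w); rewrite !inE ?eqxx ?orbT // negb_or ![w == _]eq_sym uw.
have n3 : [set v; w] != [set u; w].
  by apply: (neq _ _ v); rewrite !inE ?eqxx // negb_or eq_sym uv.
by rewrite setUC cardsU1 cards2 n1 !inE negb_or n2 n3.
Qed.

Lemma handshake (R : realFieldType) n (S : {set 'I_n}) (F : {set 'I_n} -> R) :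
  \sum_(u in S) \sum_(v in S | v != u) F [set u; v] = 2 * \sum_(e in edges S) F e.
Proof.
rewrite pair_big_dep /=.
rewrite (partition_big (fun p : 'I_n * 'I_n => [set p.1; p.2]) [in edges S]) /=; last first.
  move=> [u v] /= /and3P[uS vS vu]; rewrite inE cards2 [u == v]eq_sym vu andbT.
  by apply/subsetP => z; rewrite !inE => /orP[] /eqP->.
rewrite mulr_sumr; apply: eq_bigr => e; rewrite inE => /andP[eS /cards2P[a [b [ab ee]]]].
rewrite (eq_bigl (fun p => (p == (a, b)) || (p == (b, a)))); last first.
  move=> [u v] /=; apply/idP/idP => [/andP[/and3P[uS vS vu] /eqP uve]|].
    have : u \in e by rewrite -uve !inE eqxx.
    have : v \in e by rewrite -uve !inE eqxx orbT.
    rewrite ee !inE !xpair_eqE => /orP[] /eqP vE /orP[] /eqP uE; move: vu.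
    - by rewrite vE uE eqxx.
    - by rewrite vE uE !eqxx orbT.
    - by rewrite vE uE !eqxx.
    - by rewrite vE uE eqxx.
  have [aS bS] : a \in S /\ b \in S.
    by split; apply: (subsetP eS); rewrite ee !inE eqxx ?orbT.
  rewrite !xpair_eqE => /orP[] /andP[/eqP-> /eqP->]; rewrite aS bS /= ee.
    by rewrite eq_sym ab eqxx.
  by rewrite ab setUC eqxx.
rewrite (bigD1 (a, b)) ?eqxx //= (big_pred1 (b, a)) => [|[u v]].
  by rewrite /= [[set b; a]]setUC -ee mulr_natl mulr2n.
rewrite /= !xpair_eqE; case: eqP => [->|_] /=; last by case: eqP; rewrite ?andbF ?andbT.
by rewrite (negPf ab) /=; case: eqP.
Qed.

Lemma sum_edges3 (R : realFieldType) n (y : {set 'I_n} -> R) (u v w : 'I_n) :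
    u != v -> u != w -> v != w ->
  \sum_(e in edges [set u; v; w]) y e = y [set u; v] + y [set u; w] + y [set v; w].
Proof.
move=> uv uw vw; have neq (e e' : {set 'I_n}) z : z \in e -> z \notin e' -> e != e'.
  by move=> ze; apply: contraNneq => <-.
rewrite edges3 // setUC big_setU1 ?big_setU1 ?big_set1 /= ?inE ?negb_or.
- by rewrite addrC.
- by apply: (neq _ _ v); rewrite !inE ?eqxx ?orbT // negb_or eq_sym uv.
apply/andP; split.
  by apply: (neq _ _ w); rewrite !inE ?eqxx ?orbT // negb_or ![w == _]eq_sym uw.
by apply: (neq _ _ v); rewrite !inE ?eqxx // negb_or eq_sym uv.
Qed.

Lemma mono_triangle3 n (c : colouring n) (S : {set 'I_n}) (u v w : 'I_n) :
    u \in S -> v \in S -> w \in S -> u != v -> u != w -> v != w ->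
    c [set u; v] = c [set u; w] -> c [set u; w] = c [set v; w] ->
  [set u; v; w] \in mono_triangles c S.
Proof.
move=> Su Sv Sw uv uw vw c1 c2; rewrite inE; apply/and3P; split.
- by apply/subsetP => z; rewrite !inE => /orP[/orP[]|] /eqP->.
- by rewrite /triangle setUC cardsU1 cards2 uv !inE negb_or ![w == _]eq_sym uw vw.
apply/forallP => e; apply/forallP => e'; apply/implyP => /andP[/andP[/andP[eT e2] e'T] e'2].
have col (f : {set 'I_n}) : f \subset [set u; v; w] -> #|f| == 2 -> c f = c [set v; w].
  move=> fT f2; have : f \in edges [set u; v; w] by rewrite inE fT.
  by rewrite edges3 // !inE -c2 -c1 => /orP[/orP[]|] /eqP-> //; rewrite c1 c2.
by rewrite !col.
Qed.

Lemma mono_triangleP n (c : colouring n) (S T : {set 'I_n}) :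
    T \in mono_triangles c S ->
  exists u v w, [/\ [/\ u \in S, v \in S & w \in S], [/\ u != v, u != w & v != w],
    T = [set u; v; w], c [set u; v] = c [set u; w] & c [set u; w] = c [set v; w]].
Proof.
rewrite inE => /and3P[TS T3 mono].
have [w wT] : exists w, w \in T by apply/set0Pn; rewrite -cards_eq0 (eqP T3).
have /cards2P[u [v [uv Tw]]] : #|T :\ w| == 2.
  by move: T3; rewrite /triangle (cardsD1 w) wT.
have TE : T = [set u; v; w] by rewrite -(setD1K wT) Tw setUC.
have [uT vT] : u \in T :\ w /\ v \in T :\ w by rewrite Tw !inE !eqxx orbT.
move: uT vT; rewrite !inE => /andP[uw uT] /andP[vw vT].
have sub (z z' : 'I_n) : z \in T -> z' \in T -> [set z; z'] \subset T.
  by move=> zT z'T; apply/subsetP => x; rewrite !inE => /orP[] /eqP->.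
have col (z1 z2 z3 z4 : 'I_n) : z1 \in T -> z2 \in T -> z3 \in T -> z4 \in T ->
    z1 != z2 -> z3 != z4 -> c [set z1; z2] = c [set z3; z4].
  move=> T1 T2 T3' T4 n12 n34; move/forallP/(_ [set z1; z2])/forallP/(_ [set z3; z4]): mono.
  by rewrite !cards2 n12 n34 !sub //= => /eqP.
by exists u, v, w; split; [split; exact: (subsetP TS)|split| |exact: col|exact: col].
Qed.

Lemma edges_sub n (S T : {set 'I_n}) : T \subset S ->
  edges T = [set e in edges S | e \subset T].
Proof.
move=> TS; apply/setP => e; rewrite !inE; case eT : (e \subset T); last by rewrite andbF.
by rewrite (subset_trans eT TS) andbT.
Qed.

Lemma weak_duality (R : realFieldType) n (c : colouring n) (S : {set 'I_n})
    (y w : {set 'I_n} -> R) :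
    fractional_cover c S y -> fractional_packing c S w ->
  \sum_T w T <= \sum_(e in edges S) y e.
Proof.
move=> [y0 cov] [w0 w_out pack].
apply: (@le_trans _ _ (\sum_(T : {set 'I_n}) \sum_(e in edges S | e \subset T) w T * y e)).
  apply: ler_sum => T _; have [Tm|/w_out->] := boolP (T \in mono_triangles c S); last first.
    by apply: sumr_ge0 => *; rewrite mul0r.
  rewrite -mulr_sumr ler_peMr //.
  have [u [v [x [[Su Sv Sx] [uv ux vx] TE c1 c2]]]] := mono_triangleP Tm.
  have TS : T \subset S by move: Tm; rewrite inE => /andP[].
  rewrite (eq_bigl [in edges T]); last by move=> e; rewrite (edges_sub TS) inE.
  by rewrite TE sum_edges3 //; apply: cov.
rewrite (exchange_big_dep [in edges S]) /=; last by move=> T e _ /andP[].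
apply: ler_sum => e eS; rewrite -mulr_suml -[leRHS]mul1r ler_wpM2r //.
rewrite (eq_bigl (fun T : {set 'I_n} => e \subset T)); last by move=> T; rewrite eS.
by apply: pack; move: eS; rewrite inE => /andP[].
Qed.

Lemma optimal_pair (R : realFieldType) n (c : colouring n) (S : {set 'I_n}) :
  exists y w : {set 'I_n} -> R, [/\ fractional_cover c S y, fractional_packing c S w,
    \sum_(e in edges S) y e <= \sum_T w T &
    forall e, 0 < y e -> \sum_(T : {set 'I_n} | e \subset T) w T = 1].
Proof.
pose a (T e : {set 'I_n}) : R := ((T \in mono_triangles c S) && (e \in edges T))%:R.
pose b (T : {set 'I_n}) : R := (T \in mono_triangles c S)%:R.
have aE (y : {set 'I_n} -> R) T : T \in mono_triangles c S ->
    \sum_e a T e * y e = \sum_(e in edges T) y e.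
  move=> Tm; rewrite [RHS]big_mkcond; apply: eq_bigr => e _; rewrite /a Tm /=.
  by case: ifP; rewrite ?mul1r ?mul0r.
have [|||y [w' [y0 w'0 cov pack eqyw]]] := @lp_duality R _ _ a b.
- by move=> *; exact: ler0n.
- by move=> *; exact: ler0n.
- move=> T; rewrite ltr0n lt0b => Tm.
  have [u [v [x [_ [uv ux vx] TE _ _]]]] := mono_triangleP Tm.
  by exists [set u; v]; rewrite /a Tm TE edges3 // !inE eqxx ltr01.
pose w T := b T * w' T.
have w0 T : 0 <= w T by rewrite mulr_ge0 ?ler0n.
have wa (e : {set 'I_n}) : #|e| == 2 ->
    \sum_(T : {set 'I_n} | e \subset T) w T = \sum_T a T e * w' T.
  move=> e2; rewrite big_mkcond; apply: eq_bigr => T _; rewrite /w /a /b !inE e2 andbT.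
  by case: ifP => _; rewrite ?andbT ?andbF ?mul0r.
exists y, w; split.
- split=> // u v x Su Sv Sx uv ux vx c1 c2.
  have Tm := mono_triangle3 Su Sv Sx uv ux vx c1 c2.
  by have := cov [set u; v; x]; rewrite aE // sum_edges3 // /b Tm.
- split=> //; first by move=> T /negPf Tm; rewrite /w /b Tm mul0r.
  by move=> e e2; rewrite wa.
- rewrite /w -eqyw big_mkcond; apply: ler_sum => e _; case: ifP => // _; exact: y0.
- move=> e ye; rewrite -(complementary_slackness y0 w'0 cov pack eqyw ye).
  have [e2|e2] := boolP (#|e| == 2); first exact: wa.
  (* A set that is not an edge has a zero column, so slackness would give 0 = 1: its weight [y e]
     cannot be positive. *)
  have : \sum_T a T e * w' T = 0.
    by rewrite big1 // => T _; rewrite /a [e \in _]inE (negPf e2) !andbF mul0r.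
  rewrite (complementary_slackness y0 w'0 cov pack eqyw ye) => /eqP.
  by rewrite oner_eq0.
Qed.

Lemma sum_edgesD1 (R : realFieldType) n (S : {set 'I_n}) (y : {set 'I_n} -> R) v :
  v \in S ->
  \sum_(e in edges S) y e = \sum_(e in edges (S :\ v)) y e + degree S y v.
Proof.
move=> vS; apply: (@mulfI _ 2); first by rewrite pnatr_eq0.
rewrite mulrDr -!handshake (bigD1 v) //= addrC.
rewrite (eq_bigr (fun u => y [set u; v] + \sum_(x in S :\ v | x != u) y [set u; x]));
  last first.
  move=> u /andP[uS uv]; rewrite (bigD1 v) /=; last by rewrite vS eq_sym.
  congr (_ + _).
  by apply: eq_bigl => x; rewrite !inE; case: (x \in S); case: (x == u); case: (x == v).
rewrite big_split /= -/(degree S y v).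
have -> : \sum_(x in S | x != v) y [set v; x] = degree S y v.
  by apply: eq_bigr => u _; rewrite setUC.
rewrite (eq_bigl [in S :\ v]); last by move=> u; rewrite !inE andbC.
by ring.
Qed.

Lemma fractional_cover_sub (R : realFieldType) n (c : colouring n) (S S' : {set 'I_n})
    (y : {set 'I_n} -> R) :
  S' \subset S -> fractional_cover c S y -> fractional_cover c S' y.
Proof.
move=> /subsetP sub [y0 cov]; split=> // u v w Su Sv Sw.
by apply: cov; exact: sub.
Qed.

Lemma sum_edges_ge0 (R : realFieldType) n (c : colouring n) (S S' : {set 'I_n})
    (y : {set 'I_n} -> R) :
  fractional_cover c S y -> 0 <= \sum_(e in edges S') y e.
Proof. by case=> y0 _; apply: sumr_ge0. Qed.

(** Double counting: each edge of positive weight is saturated by the packing, and a triangle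
    contributes its weight to three edges only. *)
Lemma support_bound (R : realFieldType) n (c : colouring n) (S : {set 'I_n})
    (y w : {set 'I_n} -> R) :
    fractional_packing c S w ->
    (forall e, 0 < y e -> \sum_(T : {set 'I_n} | e \subset T) w T = 1) ->
  #|[set e in edges S | 0 < y e]|%:R <= 3 * \sum_T w T.
Proof.
move=> [w0 w_out pack] slack; rewrite -sumr_const.
apply: (@le_trans _ _ (\sum_(e in edges S) \sum_(T : {set 'I_n} | e \subset T) w T)).
  rewrite [leRHS](bigID (fun e => 0 < y e)) /= -[leLHS]addr0; apply: lerD; last first.
    by apply: sumr_ge0 => e _; apply: sumr_ge0.
  rewrite le_eqVlt; apply/orP; left; apply/eqP; apply: eq_big => e.
    by rewrite inE.
  by rewrite inE => /andP[_ /slack->].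
rewrite (exchange_big_dep predT) //= mulr_sumr; apply: ler_sum => T _.
have [Tm|/w_out->] := boolP (T \in mono_triangles c S); last first.
  by rewrite mulr0 big1.
rewrite sumr_const -[w T *+ _]mulr_natl ler_wpM2r // ler_nat.
move: Tm; rewrite inE => /andP[TS /andP[/eqP T3 _]].
have -> : 3%N = 'C(#|T|, 2) by rewrite T3.
rewrite -card_edges; apply/subset_leq_card/subsetP => e.
by rewrite (edges_sub TS) [in X in _ -> X]inE.
Qed.

Lemma bin2_natr (R : realFieldType) m : ('C(m, 2)%:R : R) * 2 = m%:R * (m%:R - 1).
Proof.
have /(congr1 (fun k => k%:R : R)) := bin_ffact m 2.
rewrite natrM => ->; case: m => [|m]; first by rewrite mul0r.
by rewrite ffactnS ffactn1 natrM -natr1 addrK.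
Qed.

(** The quadratic term grows by exactly [lam * #|S|] when [#|S|] is reached from one vertex fewer,
    which is the degree bound needed in a minimal counterexample. The term [n0%:R ^+ 2] makes the
    claim trivial up to size [n0]; beyond that size the [+ 6] of [zero_triangle_bound] is
    absorbed. *)
Lemma fractional_cover_bound (R : realFieldType) (lam : R) (n0 : nat) :
    0 <= lam -> 6 < n0%:R * (1 - 6 * lam) ->
  forall n (c : colouring n) (S : {set 'I_n}) (y : {set 'I_n} -> R),
    fractional_cover c S y ->
  lam / 2 * (#|S|%:R * (#|S|%:R + 1)) - n0%:R ^+ 2 <= \sum_(e in edges S) y e.
Proof.
move=> lam0 big_n0 n c S y.
have n0_gt0 : 0 < (n0%:R : R).
  rewrite ltr0n lt0n; apply: contraTneq big_n0 => ->.
  by rewrite mul0r -leNgt.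
have lam6 : lam < 1 / 6.
  rewrite ltNge; apply/negP => lam6; have : n0%:R * (1 - 6 * lam) <= 0.
    by apply: mulr_ge0_le0; [exact: ltW|lra].
  by move: big_n0; lra.
have [m] := ubnP #|S|; elim: m S y => // m IHm S y Sm cov.
have [small|big] := leqP #|S| n0.
  apply: le_trans (sum_edges_ge0 S cov); rewrite subr_le0.
  have : (#|S|%:R : R) <= n0%:R by rewrite ler_nat.
  have : 0 <= (#|S|%:R : R) by rewrite ler0n.
  have : 1 <= (n0%:R : R) by move: n0_gt0; rewrite ltr0n -(ler_nat R).
  clear -lam0 lam6; move: (#|S|%:R) n0%:R => p q q1 p0 pq.
  have : lam / 2 * (p * (p + 1)) <= 1 / 12 * (p * (p + 1)).
    by apply: ler_wpM2r; [rewrite mulr_ge0 // addr_ge0|lra].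
  have : p * (p + 1) <= q * (q + q) by apply: ler_pM => //; lra.
  by have := sqr_ge0 q; lra.
have [y' [w [cov' pack le_yw slack]]] := optimal_pair R c S.
rewrite leNgt; apply/negP => lt_y.
have lt_w := le_lt_trans (weak_duality cov pack) lt_y.
have s_gt0 : 0 < (#|S|%:R : R) by rewrite ltr0n (leq_ltn_trans _ big).
have deg v : v \in S -> degree S y' v <= lam * #|S|%:R.
  move=> vS; have cov1 := fractional_cover_sub (subD1set S v) cov'.
  have card1 : #|S| = #|S :\ v|.+1 by rewrite (cardsD1 v S) vS.
  have := IHm (S :\ v) y' _ cov1; rewrite -ltnS -card1 => /(_ Sm).
  have sS : #|S|%:R = #|S :\ v|%:R + 1 :> R by rewrite card1 natr1.
  have := sum_edgesD1 y' vS; move: le_yw lt_w; rewrite sS; clear.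
  by move: #|S :\ v|%:R n0%:R => s q; lra.
have s_big : 6 < #|S|%:R * (1 - 6 * lam).
  have l1 : 0 < 1 - 6 * lam by clear -lam6; lra.
  by apply: lt_trans big_n0 _; rewrite ltr_pM2r // ltr_nat.
pose adj u v := (u != v) && (y' [set u; v] == 0).
have adjC : symmetric adj by move=> u v; rewrite /adj eq_sym setUC.
have [/existsP[u /existsP[v /existsP[x]]]|notri] := boolP [exists u, exists v, exists x,
  [&& u \in S, v \in S, x \in S, adj u v, adj u x & adj v x]].
  move=> /and5P[uS vS xS /andP[uv /eqP yuv]] /andP[/andP[ux /eqP yux] /andP[vx /eqP yvx]].
  have := zero_triangle_bound cov' deg (And3 uS vS xS) (And3 uv ux vx) (And3 yuv yux yvx).
  by move: s_big; clear; lra.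
have /(mantel adjC) : forall u v x, u \in S -> v \in S -> x \in S ->
    adj u v -> adj u x -> ~~ adj v x.
  move=> u v x uS vS xS uv ux; apply/negP => vx; move/negP: notri; apply.
  apply/existsP; exists u; apply/existsP; exists v; apply/existsP; exists x.
  by rewrite uS vS xS uv ux vx.
rewrite -(ler_nat R) natrM natr_sum natrX.
have -> : \sum_(u in S) (#|[set v in S | adj u v]|%:R : R)
    = 2 * \sum_(e in edges S) (y' e == 0)%R%:R.
  rewrite -handshake; apply: eq_bigr => u _.
  rewrite -sumr_const big_mkcond [RHS]big_mkcond; apply: eq_bigr => v _.
  rewrite inE /adj eq_sym; case: (v \in S) => //=; case: (v == u) => //=.
  by case: (_ == 0).
have zeros : \sum_(e in edges S) (y' e == 0)%R%:R
    = 'C(#|S|, 2)%:R - #|[set e in edges S | 0 < y' e]|%:R :> R.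
  rewrite -card_edges -!sumr_const; apply/eqP; rewrite -subr_eq opprK; apply/eqP.
  rewrite [X in _ + X](_ : _ = \sum_(e in edges S) (0 < y' e)%R%:R).
    rewrite -big_split; apply: eq_bigr => e _ /=.
    by have [/(_ e)] := cov'; rewrite le_eqVlt eq_sym => /orP[/eqP->|ye];
       rewrite ?eqxx ?ltxx ?addr0 // ye (gt_eqF ye) add0r.
  rewrite big_mkcond [RHS]big_mkcond; apply: eq_bigr => e _; rewrite inE.
  by case: (e \in edges S) => //=; case: (0 < y' e).
rewrite zeros; have := support_bound pack slack; have := bin2_natr R #|S|.
(* With [s = #|S|], Mantel leaves at least [s^2/4 - s/2] edges of positive weight, while slackness
   allows fewer than [3 * lam / 2 * s * (s + 1)], which is below [(s - 6) * (s + 1) / 4] by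
   [s_big]. *)
have := sqr_ge0 (n0%:R : R).
by move: s_big lt_w s_gt0; clear; nra.
Qed.

Lemma fractional_packing_bound (R : realFieldType) (lam : R) (n0 : nat) :
    0 <= lam -> 6 < n0%:R * (1 - 6 * lam) ->
  forall n (c : colouring n) (S : {set 'I_n}), exists2 w : {set 'I_n} -> R,
    fractional_packing c S w &
    lam / 2 * (#|S|%:R * (#|S|%:R + 1)) - n0%:R ^+ 2 <= \sum_T w T.
Proof.
move=> lam0 n0_big n c S; have [y [w [cov pack le_yw _]]] := optimal_pair R c S.
by exists w => //; apply: le_trans (fractional_cover_bound lam0 n0_big cov) le_yw.
Qed.

(** * The nibble *)

Definition expect (R : realFieldType) (X : finType) (L : nat) (mu : X -> R)
    (F : {ffun 'I_L -> X} -> R) : R :=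
  \sum_(om : {ffun 'I_L -> X}) (\prod_i mu (om i)) * F om.

Lemma expect_prod (R : realFieldType) (X : finType) (L : nat) (mu : X -> R)
    (f : 'I_L -> X -> R) :
  expect mu (fun om => \prod_i f i (om i)) = \prod_i \sum_x mu x * f i x.
Proof.
rewrite /expect bigA_distr_bigA; apply: eq_bigr => om _.
by rewrite -big_split.
Qed.

Lemma expect_sum (R : realFieldType) (X I : finType) (L : nat) (mu : X -> R)
    (P : pred I) (F : I -> {ffun 'I_L -> X} -> R) :
  expect mu (fun om => \sum_(i | P i) F i om) = \sum_(i | P i) expect mu (F i).
Proof.
by rewrite /expect exchange_big /=; apply: eq_bigr => om _; rewrite mulr_sumr.
Qed.

Lemma expectD (R : realFieldType) (X : finType) (L : nat) (mu : X -> R)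
    (F G : {ffun 'I_L -> X} -> R) :
  expect mu (fun om => F om + G om) = expect mu F + expect mu G.
Proof. by rewrite /expect -big_split; apply: eq_bigr => om _; rewrite mulrDr. Qed.

Lemma expectZ (R : realFieldType) (X : finType) (L : nat) (mu : X -> R) (c : R)
    (F : {ffun 'I_L -> X} -> R) :
  expect mu (fun om => c * F om) = c * expect mu F.
Proof. by rewrite /expect mulr_sumr; apply: eq_bigr => om _; rewrite mulrCA. Qed.

Lemma le_expect (R : realFieldType) (X : finType) (L : nat) (mu : X -> R)
    (F G : {ffun 'I_L -> X} -> R) :
  (forall x, 0 <= mu x) -> (forall om, F om <= G om) -> expect mu F <= expect mu G.
Proof.
move=> mu0 FG; apply: ler_sum => om _; rewrite ler_wpM2l //.
by apply: prodr_ge0.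
Qed.

Lemma expect_cst (R : realFieldType) (X : finType) (L : nat) (mu : X -> R) (c : R) :
  \sum_x mu x = 1 -> expect (L := L) mu (fun=> c) = c.
Proof.
move=> mu1; rewrite -[c in LHS]mulr1 (expectZ mu c (fun=> 1)).
have /= := expect_prod mu (fun (_ : 'I_L) (_ : X) => 1).
rewrite [RHS]big1 => [|i _]; last by under eq_bigr do rewrite mulr1.
by rewrite big1_eq => ->; rewrite mulr1.
Qed.

Lemma expect_exists (R : realFieldType) (X : finType) (L : nat) (mu : X -> R)
    (F : {ffun 'I_L -> X} -> R) (c : R) :
    (forall x, 0 <= mu x) -> \sum_x mu x = 1 -> c <= expect mu F ->
  exists om, c <= F om.
Proof.
move=> mu0 mu1 cF; apply/existsP; apply: contraLR cF; rewrite negb_exists -ltNge.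
move=> /forallP Fc; have {}Fc om : F om < c by have := Fc om; rewrite -ltNge.
rewrite -[ltRHS](expect_cst L c mu1) /expect.
rewrite -subr_gt0 -sumrB.
have ge0 (om : {ffun 'I_L -> X}) : 0 <= (\prod_i mu (om i)) * c - (\prod_i mu (om i)) * F om.
  by rewrite -mulrBr mulr_ge0 ?prodr_ge0 // subr_ge0 ltW.
rewrite lt0r sumr_ge0 ?andbT; last by move=> *; exact: ge0.
apply/negP => /eqP /psumr_eq0P-/(_ (fun om _ => ge0 om)) all0.
have := expect_cst L 1 mu1; rewrite /expect big1 => [/eqP|om _].
  by rewrite eq_sym oner_eq0.
have /eqP := all0 om isT; rewrite -mulrBr mulf_eq0 subr_eq0 => /orP[/eqP->|].
  by rewrite mul0r.
by rewrite gt_eqF.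
Qed.

Lemma prod_bool (R : realFieldType) (I : finType) (b : pred I) :
  \prod_i (b i)%:R = [forall i, b i]%:R :> R.
Proof.
have [/forallP bT|] := boolP [forall i, b i]; first by rewrite big1 // => i _; rewrite bT.
by rewrite negb_forall => /existsP[i /negPf bi]; rewrite (bigD1 i) //= bi mul0r.
Qed.

(** * Estimates for powers close to 1 *)

Lemma bernoulli (R : realFieldType) (y : R) L : 0 <= y -> y <= 1 ->
  1 - L%:R * y <= (1 - y) ^+ L.
Proof.
move=> y0 y1; elim: L => [|L IH]; first by rewrite mul0r subr0.
have L0 : 0 <= (L%:R : R) by rewrite ler0n.
rewrite exprS -natr1; apply: le_trans (ler_wpM2l (_ : 0 <= 1 - y) IH); last lra.
by have := mulr_ge0 L0 (sqr_ge0 y); lra.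
Qed.

Lemma exp_le_inv (R : realFieldType) (y : R) L : 0 <= y -> y <= 1 ->
  (1 + y) ^+ L * (1 - L%:R * y) <= 1.
Proof.
move=> y0 y1; apply: le_trans (ler_wpM2l (exprn_ge0 _ _) (bernoulli L y0 y1)) _.
  lra.
by rewrite -exprMn exprn_ile1 //; nra.
Qed.

Lemma exp_le_quadratic (R : realFieldType) (y : R) L : 0 <= y -> y <= 1 ->
  (1 - y) ^+ L <= 1 - L%:R * y + (L%:R * y) ^+ 2.
Proof.
move=> y0 y1; elim: L => [|L IH]; first by rewrite mul0r subr0 expr0n addr0.
rewrite exprS -natr1; apply: le_trans (ler_wpM2l (_ : 0 <= 1 - y) IH) _; first lra.
have L0 : 0 <= (L%:R : R) by rewrite ler0n.
have := mulr_ge0 L0 (sqr_ge0 y); have := sqr_ge0 y.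
have := mulr_ge0 (mulr_ge0 L0 (mulr_ge0 L0 y0)) (sqr_ge0 y); nra.
Qed.

(** * Weighted 3-uniform hypergraphs and one random round *)

Definition vdeg (R : realFieldType) (V E : finType) (inc : E -> {set V}) (w : E -> R)
  (v : V) : R := \sum_(e | v \in inc e) w e.

Definition vcodeg (R : realFieldType) (V E : finType) (inc : E -> {set V}) (w : E -> R)
  (u v : V) : R := \sum_(e | (u \in inc e) && (v \in inc e)) w e.

(** A fractional matching of small codegree. In the application the vertices are the edges of the
    complete graph and the hyperedges are triangles. *)
Definition spread (R : realFieldType) (V E : finType) (inc : E -> {set V}) (A : {set V})
    (w : E -> R) (delta : R) : Prop :=
  [/\ forall e, 0 <= w e,
      forall e, 0 < w e -> inc e \subset A /\ #|inc e| = 3,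
      forall v, vdeg inc w v <= 1 &
      forall u v, u != v -> vcodeg inc w u v <= delta].

(* A round either picks a hyperedge, or discards a vertex so that all vertices
   are hit equally often, or does nothing. *)
Definition hit (V E : finType) (inc : E -> {set V}) (x : E + V + unit) : {set V} :=
  match x with inl (inl e) => inc e | inl (inr v) => [set v] | inr _ => set0 end.

Definition round (R : realFieldType) (V E : finType) (inc : E -> {set V}) (A : {set V})
    (w : E -> R) (x : E + V + unit) : R :=
  match x with
  | inl (inl e) => w e / #|A|%:R
  | inl (inr v) => (v \in A)%:R * ((1 - vdeg inc w v) / #|A|%:R)
  | inr _ => 2 * (\sum_e w e) / #|A|%:R
  end.

Definition miss (R : realFieldType) (V E : finType) (inc : E -> {set V}) (A : {set V})
    (w : E -> R) (S : {set V}) : R :=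
  \sum_x round inc A w x * [disjoint hit inc x & S]%:R.

Lemma sum_round (R : realFieldType) (V E : finType) (F : E + V + unit -> R) :
  \sum_x F x = \sum_e F (inl (inl e)) + \sum_v F (inl (inr v)) + F (inr tt).
Proof.
rewrite big_sumType /= big_sumType /=; congr (_ + _).
by rewrite (bigD1 tt) //= big1 ?addr0 // => -[].
Qed.

Lemma sum_bool (R : realFieldType) (T : finType) (S S' : {set T}) :
  \sum_(v in S) (v \in S')%:R = #|S' :&: S|%:R :> R.
Proof.
rewrite -sumr_const big_mkcond [RHS]big_mkcond; apply: eq_bigr => v _.
by rewrite inE andbC; case: (v \in S); case: (v \in S').
Qed.

Lemma sum_pair_bool (R : realFieldType) (T : finType) (H S : {set T}) :
  \sum_(u in S) \sum_(v in S | v != u) ((u \in H) && (v \in H))%:R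
    = #|H :&: S|%:R * #|H :&: S|%:R - #|H :&: S|%:R :> R.
Proof.
rewrite -{1 3}sum_bool mulr_suml -sumrB; apply: eq_bigr => u uS.
rewrite -sum_bool [in RHS](bigD1 u) //= mulrDr.
case: (u \in H); rewrite /= ?mul0r ?mul1r ?subr0.
  by rewrite addrC addKr.
by rewrite add0r big1.
Qed.

Lemma sum_vdeg (R : realFieldType) (V E : finType) (inc : E -> {set V}) (A : {set V})
    (w : E -> R) (delta : R) :
  spread inc A w delta -> \sum_(v in A) vdeg inc w v = 3 * \sum_e w e.
Proof.
move=> [w0 supp _ _]; rewrite /vdeg mulr_sumr.
rewrite (eq_bigr (fun v => \sum_e w e * (v \in inc e)%:R)); last first.
  move=> v _; rewrite big_mkcond; apply: eq_bigr => e _.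
  by case: (v \in inc e); rewrite ?mulr1 ?mulr0.
rewrite exchange_big; apply: eq_bigr => e _ /=; rewrite -mulr_sumr sum_bool.
have := w0 e; rewrite le_eqVlt => /orP[/eqP<-|/supp[eA e3]]; first by rewrite mul0r mulr0.
by rewrite (setIidPl eA) e3 mulrC.
Qed.

(** A hyperedge has six ordered pairs of vertices. The bound makes the total weight negligible when
    [A] is too small for a round of the nibble. *)
Lemma sum_vcodeg (R : realFieldType) (V E : finType) (inc : E -> {set V}) (A : {set V})
    (w : E -> R) (delta : R) :
  0 <= delta -> spread inc A w delta -> 6 * \sum_e w e <= #|A|%:R ^+ 2 * delta.
Proof.
move=> delta0 [w0 supp _ cod].
have -> : 6 * \sum_e w e = \sum_(u in A) \sum_(v in A | v != u) vcodeg inc w u v.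
  rewrite mulr_sumr (eq_bigr (fun u => \sum_e w e *
    \sum_(v in A | v != u) ((u \in inc e) && (v \in inc e))%:R)); last first.
    move=> u _; under [RHS]eq_bigr do rewrite mulr_sumr.
    rewrite exchange_big; apply: eq_bigr => v _ /=; rewrite /vcodeg big_mkcond.
    by apply: eq_bigr => e _; case: (_ && _); rewrite ?mulr1 ?mulr0.
  rewrite exchange_big; apply: eq_bigr => e _ /=; rewrite -mulr_sumr sum_pair_bool.
  have := w0 e; rewrite le_eqVlt => /orP[/eqP<-|/supp[eA e3]]; first by rewrite !mul0r mulr0.
  by rewrite (setIidPl eA) e3; ring.
rewrite expr2 -mulrA mulr_natl -sumr_const; apply: ler_sum => u _.
rewrite mulr_natl -sumr_const [leLHS]big_mkcondr /=; apply: ler_sum => v _.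
by case: ifP => // vu; apply: cod; rewrite eq_sym.
Qed.

Lemma round_ge0 (R : realFieldType) (V E : finType) (inc : E -> {set V}) (A : {set V})
    (w : E -> R) (delta : R) x :
  spread inc A w delta -> 0 <= round inc A w x.
Proof.
move=> [w0 _ d1 _]; case: x => [[e|v]|u] /=.
- by rewrite divr_ge0 ?ler0n.
- by rewrite mulr_ge0 ?divr_ge0 ?ler0n // subr_ge0.
- by rewrite divr_ge0 ?ler0n // mulr_ge0 // sumr_ge0.
Qed.

Lemma sum_round1 (R : realFieldType) (V E : finType) (inc : E -> {set V}) (A : {set V})
    (w : E -> R) (delta : R) :
  spread inc A w delta -> A != set0 -> \sum_x round inc A w x = 1.
Proof.
move=> sp A0; have m0 : (#|A|%:R : R) != 0 by rewrite pnatr_eq0 cards_eq0.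
rewrite sum_round /= -mulr_suml.
rewrite [X in _ + X + _](_ : _ = \sum_(v in A) (1 - vdeg inc w v) / #|A|%:R); last first.
  by rewrite [RHS]big_mkcond; apply: eq_bigr => v _; case: (v \in A); rewrite ?mul1r ?mul0r.
rewrite -mulr_suml sumrB sumr_const (sum_vdeg sp) -!mulrDl.
have -> : \sum_e w e + (#|A|%:R - 3 * \sum_e w e) + 2 * \sum_e w e = #|A|%:R by ring.
exact: mulfV.
Qed.

Lemma round_hit (R : realFieldType) (V E : finType) (inc : E -> {set V}) (A : {set V})
    (w : E -> R) v :
  v \in A -> \sum_x round inc A w x * (v \in hit inc x)%:R = #|A|%:R^-1.
Proof.
move=> vA; rewrite sum_round /= inE mulr0 addr0.
rewrite [X in X + _](_ : _ = vdeg inc w v / #|A|%:R); last first.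
  rewrite /vdeg mulr_suml [RHS]big_mkcond; apply: eq_bigr => e _.
  by case: (v \in inc e); rewrite ?mulr1 ?mulr0.
rewrite (bigD1 v) //= inE eqxx vA mul1r mulr1 big1 ?addr0 => [|u uv].
  by rewrite -mulrDl addrC subrK mul1r.
by rewrite inE eq_sym (negPf uv) mulr0.
Qed.

Lemma round_hit2 (R : realFieldType) (V E : finType) (inc : E -> {set V}) (A : {set V})
    (w : E -> R) (delta : R) u v :
  spread inc A w delta -> u != v ->
  \sum_x round inc A w x * ((u \in hit inc x) && (v \in hit inc x))%:R
    <= delta / #|A|%:R.
Proof.
move=> [_ _ _ cod] uv; rewrite sum_round /= inE mulr0 addr0.
rewrite [X in _ + X]big1 ?addr0 => [|z _]; last first.
  rewrite !inE; case: eqP => [<-|]; last by rewrite mulr0.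
  by rewrite eq_sym (negPf uv) mulr0.
apply: le_trans (ler_wpM2r _ (cod u v uv)); last by rewrite invr_ge0 ler0n.
rewrite le_eqVlt; apply/orP; left; apply/eqP.
rewrite /vcodeg mulr_suml [RHS]big_mkcond; apply: eq_bigr => e _.
by case: (_ && _); rewrite ?mulr1 ?mulr0.
Qed.

Lemma disjoint_ge (R : realFieldType) (T : finType) (H S : {set T}) :
  1 - \sum_(v in S) (v \in H)%:R <= [disjoint H & S]%:R :> R.
Proof.
rewrite sum_bool -setI_eq0 -cards_eq0; case: #|_| => [|k].
  by rewrite subr0 eqxx.
by rewrite /= subr_le0 ler1n.
Qed.

(** A Bonferroni bound over ordered pairs: if [H] and [S] share k points, the right side is
    [(k - 1)^2]. *)
Lemma disjoint_le (R : realFieldType) (T : finType) (H S : {set T}) :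
  [disjoint H & S]%:R <= 1 - \sum_(v in S) (v \in H)%:R
    + \sum_(u in S) \sum_(v in S | v != u) ((u \in H) && (v \in H))%:R :> R.
Proof.
rewrite sum_pair_bool sum_bool -setI_eq0 -cards_eq0; case: #|_| => [|k].
  by rewrite eqxx mul0r !subr0 addr0.
rewrite /= -natr1; have := ler0n R k; have := sqr_ge0 (k%:R : R); nra.
Qed.

Lemma miss1 (R : realFieldType) (V E : finType) (inc : E -> {set V}) (A : {set V})
    (w : E -> R) (delta : R) v :
  spread inc A w delta -> v \in A -> miss inc A w [set v] = 1 - #|A|%:R^-1.
Proof.
move=> sp vA; have A0 : A != set0 by apply/set0Pn; exists v.
rewrite -[X in _ = X - _](sum_round1 sp A0) -(round_hit inc w vA) -sumrB; apply: eq_bigr => x _.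
rewrite -[X in X - _]mulr1 -mulrBr; congr (_ * _).
by rewrite disjoint_sym disjoints1; case: (v \in _); rewrite ?subrr ?subr0.
Qed.

Lemma miss_ge (R : realFieldType) (V E : finType) (inc : E -> {set V}) (A : {set V})
    (w : E -> R) (delta : R) (S : {set V}) :
  spread inc A w delta -> A != set0 -> S \subset A ->
  1 - #|S|%:R / #|A|%:R <= miss inc A w S.
Proof.
move=> sp A0 SA.
have -> : 1 - #|S|%:R / #|A|%:R = \sum_x round inc A w x *
    (1 - \sum_(v in S) (v \in hit inc x)%:R) :> R.
  under eq_bigr do rewrite mulrBr mulr1 mulr_sumr.
  rewrite sumrB (sum_round1 sp A0) exchange_big; congr (_ - _) => /=.
  rewrite mulr_natl -sumr_const; apply: eq_bigr => v vS.
  by rewrite round_hit // (subsetP SA).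
by apply: ler_sum => x _; rewrite ler_wpM2l ?(round_ge0 _ sp) // disjoint_ge.
Qed.

Lemma miss_le (R : realFieldType) (V E : finType) (inc : E -> {set V}) (A : {set V})
    (w : E -> R) (delta : R) (S : {set V}) :
  0 <= delta -> spread inc A w delta -> A != set0 -> S \subset A ->
  miss inc A w S <= 1 - #|S|%:R / #|A|%:R + #|S|%:R ^+ 2 * delta / #|A|%:R.
Proof.
move=> delta0 sp A0 SA.
apply: (@le_trans _ _ (\sum_x round inc A w x * (1 - \sum_(v in S) (v \in hit inc x)%:R
    + \sum_(u in S) \sum_(v in S | v != u) ((u \in hit inc x) && (v \in hit inc x))%:R))).
  by apply: ler_sum => x _; rewrite ler_wpM2l ?(round_ge0 _ sp) // disjoint_le.
under eq_bigr do rewrite mulrDr mulrBr mulr1 mulr_sumr.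
rewrite big_split sumrB (sum_round1 sp A0) /= exchange_big.
apply: lerD.
  rewrite lerD2l lerN2 mulr_natl -sumr_const; apply: ler_sum => v vS /=.
  by rewrite round_hit // (subsetP SA).
under eq_bigr do rewrite mulr_sumr.
rewrite exchange_big -mulrA expr2 -mulrA mulr_natl -sumr_const; apply: ler_sum => u uS /=.
under eq_bigr do rewrite mulr_sumr.
rewrite exchange_big mulr_natl -sumr_const [leLHS]big_mkcondr /=; apply: ler_sum => v vS.
case: ifP => [vu|_]; last by rewrite divr_ge0 ?ler0n.
by apply: round_hit2 sp _; rewrite eq_sym.
Qed.

Lemma miss_ge0 (R : realFieldType) (V E : finType) (inc : E -> {set V}) (A : {set V})
    (w : E -> R) (delta : R) (S : {set V}) :
  spread inc A w delta -> 0 <= miss inc A w S.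
Proof. by move=> sp; apply: sumr_ge0 => x _; rewrite mulr_ge0 ?(round_ge0 _ sp) ?ler0n. Qed.

Lemma miss_le1 (R : realFieldType) (V E : finType) (inc : E -> {set V}) (A : {set V})
    (w : E -> R) (delta : R) (S : {set V}) :
  spread inc A w delta -> A != set0 -> miss inc A w S <= 1.
Proof.
move=> sp A0; rewrite -(sum_round1 sp A0); apply: ler_sum => x _.
by rewrite -[leRHS]mulr1 ler_wpM2l ?(round_ge0 _ sp) // lern1 leq_b1.
Qed.

(** * Many rounds: survival, trimming and isolated hyperedges *)

Definition survive (V E : finType) (inc : E -> {set V}) (L : nat)
    (om : {ffun 'I_L -> E + V + unit}) (S : {set V}) : bool :=
  [forall i, [disjoint hit inc (om i) & S]].

Lemma expect_survive (R : realFieldType) (V E : finType) (inc : E -> {set V})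
    (A : {set V}) (w : E -> R) (L : nat) (S : {set V}) :
  expect (round inc A w) (fun om : {ffun 'I_L -> _} => (survive inc om S)%:R)
    = miss inc A w S ^+ L.
Proof.
have -> : miss inc A w S ^+ L = \prod_(i < L) miss inc A w S.
  by rewrite prodr_const card_ord.
rewrite -(expect_prod (round inc A w) (fun _ x => [disjoint hit inc x & S]%:R)).
by apply: eq_bigr => om _; rewrite prod_bool.
Qed.

Definition excess (R : realFieldType) (V E : finType) (inc : E -> {set V}) (w : E -> R)
  (v : V) : R := Num.max 0 (vdeg inc w v - 1).

(** Restores degrees at most 1. If a degree is 1 + x, the factor at its hyperedges is at most
    [max 0 (1 - x)], and [(1 + x) * (1 - x) <= 1]. Adding the excesses of the vertices keeps the
    total loss a sum over vertices. *)
Definition trim (R : realFieldType) (V E : finType) (inc : E -> {set V}) (w : E -> R)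
  (e : E) : R := w e * Num.max 0 (1 - \sum_(v in inc e) excess inc w v).

Lemma excess_ge0 (R : realFieldType) (V E : finType) (inc : E -> {set V}) (w : E -> R) v :
  0 <= excess inc w v.
Proof. by rewrite le_max lexx. Qed.

Lemma trim_ge0 (R : realFieldType) (V E : finType) (inc : E -> {set V}) (w : E -> R) e :
  0 <= w e -> 0 <= trim inc w e.
Proof. by move=> w0; rewrite mulr_ge0 // le_max lexx. Qed.

Lemma trim_le (R : realFieldType) (V E : finType) (inc : E -> {set V}) (w : E -> R) e :
  0 <= w e -> trim inc w e <= w e.
Proof.
move=> w0; rewrite -[leRHS]mulr1 ler_wpM2l // ge_max ler01 gerBl.
by apply: sumr_ge0 => v _; exact: excess_ge0.
Qed.

Lemma vdeg_trim (R : realFieldType) (V E : finType) (inc : E -> {set V}) (w : E -> R) v :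
  (forall e, 0 <= w e) -> vdeg inc (trim inc w) v <= 1.
Proof.
move=> w0; apply: (@le_trans _ _ (vdeg inc w v * Num.max 0 (1 - excess inc w v))).
  rewrite /vdeg mulr_suml; apply: ler_sum => e ve; rewrite ler_wpM2l //.
  rewrite ge_max !le_max lexx /= (bigD1 v) //= opprD addrA; apply/orP; right.
  by rewrite gerBl; apply: sumr_ge0 => u _; exact: excess_ge0.
have d0 : 0 <= vdeg inc w v by apply: sumr_ge0.
rewrite /excess; move: (vdeg inc w v) d0 => d d0.
have [d1|d1] := lerP (d - 1) 0; first by rewrite subr0 max_r ?ler01 // mulr1; lra.
have [d2|d2] := lerP (1 - (d - 1)) 0; first by rewrite mulr0 ler01.
by have := sqr_ge0 (d - 1); lra.
Qed.

Lemma sum_trim (R : realFieldType) (V E : finType) (inc : E -> {set V}) (w : E -> R) :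
  (forall e, 0 <= w e) ->
  \sum_e w e - \sum_v vdeg inc w v * excess inc w v <= \sum_e trim inc w e.
Proof.
move=> w0; rewrite lerBlDr -lerBlDl -sumrB.
have -> : \sum_v vdeg inc w v * excess inc w v
    = \sum_e w e * \sum_(v in inc e) excess inc w v.
  under eq_bigr do rewrite /vdeg mulr_suml big_mkcond.
  rewrite exchange_big; apply: eq_bigr => e _ /=.
  by rewrite mulr_sumr [RHS]big_mkcond.
apply: ler_sum => e _; rewrite /trim -[X in X - _]mulr1 -mulrBr ler_wpM2l //.
by rewrite lerBlDr -lerBlDl le_max lexx orbT.
Qed.

(** Discarded vertices count as hits too. The condition therefore splits into one condition per
    round, and its probability is a product. *)
Definition isolated (V E : finType) (inc : E -> {set V}) (L : nat)
    (om : {ffun 'I_L -> E + V + unit}) (e : E) (i : 'I_L) : bool :=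
  [forall j, if j == i then om j == inl (inl e)
             else [disjoint hit inc (om j) & inc e]].

Lemma isolatedP (V E : finType) (inc : E -> {set V}) (L : nat)
    (om : {ffun 'I_L -> E + V + unit}) (e : E) (i : 'I_L) :
  isolated inc om e i ->
  om i = inl (inl e) /\ forall j, j != i -> [disjoint hit inc (om j) & inc e].
Proof.
move=> /forallP iso; split; first by have := iso i; rewrite eqxx => /eqP.
by move=> j ji; have := iso j; rewrite (negPf ji).
Qed.

Lemma isolated_uniq (V E : finType) (inc : E -> {set V}) (L : nat)
    (om : {ffun 'I_L -> E + V + unit}) (e : E) (i j : 'I_L) :
  inc e != set0 -> isolated inc om e i -> isolated inc om e j -> i = j.
Proof.
move=> e0 /isolatedP[_ iso] /isolatedP[omj _]; apply/eqP; rewrite eq_sym.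
apply: contraNT e0 => ji; have := iso j ji; rewrite omj /= -setI_eq0.
by rewrite setIid.
Qed.

Lemma expect_isolated (R : realFieldType) (V E : finType) (inc : E -> {set V})
    (A : {set V}) (w : E -> R) (delta : R) (L : nat) (e : E) (i : 'I_L) :
  spread inc A w delta -> A != set0 ->
  w e / #|A|%:R * miss inc A w (inc e) ^+ L <=
  expect (round inc A w) (fun om : {ffun 'I_L -> _} => (isolated inc om e i)%:R).
Proof.
move=> sp A0.
pose f (j : 'I_L) (x : E + V + unit) : bool :=
  if j == i then x == inl (inl e) else [disjoint hit inc x & inc e].
have -> : expect (round inc A w) (fun om : {ffun 'I_L -> _} => (isolated inc om e i)%:R)
    = \prod_j \sum_x round inc A w x * (f j x)%:R.
  rewrite -(expect_prod (round inc A w) (fun j x => (f j x)%:R)).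
  by apply: eq_bigr => om _; rewrite prod_bool.
rewrite (bigD1 i) //=; apply: ler_pM.
- by rewrite divr_ge0 ?ler0n //; case: sp.
- by rewrite exprn_ge0 // (miss_ge0 _ sp).
- rewrite /f eqxx (bigD1 (inl (inl e))) //= eqxx mulr1 lerDl.
  by apply: sumr_ge0 => x _; rewrite mulr_ge0 ?(round_ge0 _ sp) ?ler0n.
rewrite (eq_bigr (fun=> miss inc A w (inc e))) => [|j /negPf ji]; last first.
  by rewrite /f ji.
(* There are at most [L] other rounds, and a power of a number in [0, 1] decreases with the
   exponent. *)
rewrite prodr_const; apply: ler_wiXn2l; rewrite ?(miss_ge0 _ sp) ?(miss_le1 _ sp) //.
by rewrite -[leqRHS]card_ord max_card.
Qed.

(** The quotient is the rescaling factor of [thin]: survival of a vertex against the lower bound for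
    survival of a hyperedge. For these [y], [1 - y <= (1 + 4 * y) * (1 - 3 * y)]. *)
Lemma survival_ratio (R : realFieldType) (y : R) L : 0 <= y -> y <= 1 / 16 ->
  L%:R * y <= 1 / 8 -> (1 - y) ^+ L / (1 - 3 * y) ^+ L <= 2.
Proof.
move=> y0 y16 Ly; have t0 : 0 < (1 - 3 * y) ^+ L by apply: exprn_gt0; lra.
rewrite ler_pdivrMr //.
have b0 : 0 <= (1 + 4 * y) ^+ L by apply: exprn_ge0; lra.
have b2 : (1 + 4 * y) ^+ L <= 2.
  have e1 : (1 + 4 * y) ^+ L * (1 - L%:R * (4 * y)) <= 1 by apply: exp_le_inv; lra.
  have e2 : (1 + 4 * y) ^+ L * (1 / 2) <= (1 + 4 * y) ^+ L * (1 - L%:R * (4 * y)).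
    by apply: ler_wpM2l => //; lra.
  by lra.
apply: le_trans (ler_wpM2r (ltW t0) b2); rewrite -exprMn lerXn2r ?nnegrE; nra.
Qed.

(** Two hyperedges meeting only in v have five vertices together. Since [(1 - y) * (1 - 5 * y) <= (1
    - 3 * y) ^+ 2], given survival of v they are nearly uncorrelated, up to an error of order
    [delta]. *)
Lemma survival_pair (R : realFieldType) (y delta : R) L : 0 <= y -> y <= 1 / 16 ->
    L%:R * y <= 1 / 8 -> 0 <= delta -> delta <= 1 / 200 ->
  ((1 - y) ^+ L / (1 - 3 * y) ^+ L) ^+ 2 * (1 - 5 * y + 25 * delta * y) ^+ L
    <= (1 - y) ^+ L * (1 + 200 * delta).
Proof.
move=> y0 y16 Ly d0 d200; have t0 : 0 < (1 - 3 * y) ^+ L by apply: exprn_gt0; lra.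
have s0 : 0 <= (1 - y) ^+ L by apply: exprn_ge0; lra.
have dy0 : 0 <= delta * y by rewrite mulr_ge0.
have dy : delta * y <= 1 / 200 * (1 / 16) by apply: ler_pM.
have dLy : delta * (L%:R * y) <= delta * (1 / 8) by apply: ler_wpM2l.
have b0 : 0 <= (1 + 100 * (delta * y)) ^+ L by apply: exprn_ge0; lra.
have b1 : (1 + 100 * (delta * y)) ^+ L <= 1 + 200 * delta.
  have e1 : (1 + 100 * (delta * y)) ^+ L * (1 - L%:R * (100 * (delta * y))) <= 1.
    by apply: exp_le_inv; lra.
  have e2 : (1 + 100 * (delta * y)) ^+ L * (1 - 25 / 2 * delta)
      <= (1 + 100 * (delta * y)) ^+ L * (1 - L%:R * (100 * (delta * y))).
    by apply: ler_wpM2l => //; lra.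
  have e3 : 1 <= (1 + 200 * delta) * (1 - 25 / 2 * delta) by nra.
  have p0 : 0 < 1 - 25 / 2 * delta by lra.
  by rewrite -(ler_pM2r p0); lra.
have key : (1 - y) ^+ L * (1 - 5 * y + 25 * delta * y) ^+ L
    <= (1 + 200 * delta) * ((1 - 3 * y) ^+ L) ^+ 2.
  apply: le_trans (ler_wpM2r (exprn_ge0 _ (ltW t0)) b1).
  rewrite -exprM mulnC exprM -!exprMn lerXn2r ?nnegrE //.
  - by rewrite mulr_ge0; lra.
  - by rewrite mulr_ge0 ?sqr_ge0; lra.
  by nra.
rewrite expr_div_n mulrAC (ler_pdivrMr _ _ (exprn_gt0 2 t0)).
have := ler_wpM2l s0 key; rewrite expr2; lra.
Qed.

(* [thin] is the weight after the rounds [om]: it is rescaled so that the expected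
   degree at a surviving vertex does not drop. *)
Definition thin (R : realFieldType) (V E : finType) (inc : E -> {set V}) (w : E -> R)
    (lam : R) (L : nat) (om : {ffun 'I_L -> E + V + unit}) (e : E) : R :=
  lam * (w e * (survive inc om (inc e))%:R).

Lemma survive_sub (V E : finType) (inc : E -> {set V}) (L : nat)
    (om : {ffun 'I_L -> E + V + unit}) (S S' : {set V}) :
  S \subset S' -> survive inc om S' -> survive inc om S.
Proof.
move=> SS' /forallP alive; apply/forallP => i.
by have := alive i; rewrite ![[disjoint hit _ _ & _]]disjoint_sym; exact: disjointWl.
Qed.

Lemma survive_setU (V E : finType) (inc : E -> {set V}) (L : nat)
    (om : {ffun 'I_L -> E + V + unit}) (S S' : {set V}) :
  survive inc om (S :|: S') = survive inc om S && survive inc om S'.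
Proof.
apply/idP/andP => [alive|[/forallP a1 /forallP a2]].
  by split; apply: survive_sub alive; rewrite ?subsetUl ?subsetUr.
apply/forallP => i; have := a1 i; have := a2 i.
by rewrite -!setI_eq0 setIUr => /eqP-> /eqP->; rewrite setU0.
Qed.

(** Either [f] meets [e] only in [v], and five vertices must survive, or it contains one of the two
    other vertices of [e]; such [f] weigh at most [2 * delta] in total. *)
Lemma expect_pair (R : realFieldType) (V E : finType) (inc : E -> {set V})
    (A : {set V}) (w : E -> R) (delta : R) (L : nat) (e : E) (v : V) :
    0 <= delta -> delta <= 1 / 200 -> spread inc A w delta -> v \in inc e ->
    16 <= #|A|%:R :> R -> 0 < w e ->
  \sum_(f | v \in inc f) w f * miss inc A w (inc e :|: inc f) ^+ L
    <= vdeg inc w v * (1 - 5 * #|A|%:R^-1 + 25 * delta * #|A|%:R^-1) ^+ L + 2 * delta.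
Proof.
move=> delta0 delta1 sp ve A16 we; have [w0 supp d1 cod] := sp.
have A0 : A != set0.
  by rewrite -cards_eq0 -(pnatr_eq0 R); apply/eqP => A0; move: A16; rewrite A0; lra.
have [eA e3] := supp e we.
set q := 1 - _ + _.
have m0 : 0 < (#|A|%:R : R)^-1 by rewrite invr_gt0; lra.
have m16 : (#|A|%:R : R)^-1 <= 1 / 16.
  by rewrite div1r lef_pV2 // posrE; lra.
have q0 : 0 <= q by rewrite /q; have := mulr_ge0 delta0 (ltW m0); lra.
apply: (@le_trans _ _ (\sum_(f | v \in inc f)
    (w f * q ^+ L + \sum_(u in inc e | u != v) w f * (u \in inc f)%:R))).
  apply: ler_sum => f vf; have := w0 f; rewrite le_eqVlt => /orP[/eqP<-|wf].
    by rewrite !mul0r big1 ?addr0 // => u _; rewrite mul0r.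
  have [fA f3] := supp f wf; rewrite -mulr_sumr -mulrDr ler_wpM2l //.
  have [/existsP[u /and3P[ue uv uf]]|/existsPn only] :=
    boolP [exists u, [&& u \in inc e, u != v & u \in inc f]].
    apply: (@le_trans _ _ 1); first by rewrite exprn_ile1 ?(miss_ge0 _ sp) ?(miss_le1 _ sp).
    rewrite (bigD1 u) ?ue //= uf -[leLHS]add0r lerD ?exprn_ge0 //.
    by rewrite lerDl; apply: sumr_ge0 => *; exact: ler0n.
  have cap : inc e :&: inc f = [set v].
    apply/setP => u; rewrite !inE; have := only u; case: eqP => [->|_]; rewrite ?ve ?vf //=.
    by move=> /negPf.
  have card5 : #|inc e :|: inc f| = 5%N by rewrite cardsU e3 f3 cap cards1.
  have EF : inc e :|: inc f \subset A by rewrite subUset eA fA.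
  have := miss_le delta0 sp A0 EF; rewrite card5 => le_q.
  apply: (@le_trans _ _ (q ^+ L)); last first.
    by rewrite lerDl; apply: sumr_ge0 => *; exact: ler0n.
  rewrite lerXn2r ?nnegrE ?(miss_ge0 _ sp) //; apply: le_trans le_q _.
  by rewrite /q le_eqVlt; apply/orP; left; apply/eqP; ring.
rewrite big_split /= -mulr_suml lerD2l exchange_big /=.
apply: (@le_trans _ _ (\sum_(u in inc e | u != v) delta)).
  apply: ler_sum => u /andP[ue uv]; apply: le_trans (cod u v uv).
  rewrite /vcodeg [leLHS]big_mkcond [leRHS]big_mkcond; apply: ler_sum => f _.
  by case: (u \in inc f); case: (v \in inc f); rewrite ?mulr0 ?mulr1.
rewrite sumr_const -[delta *+ _]mulr_natl ler_wpM2r // ler_nat.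
have <- : #|inc e :\ v| = 2%N by have := cardsD1 v (inc e); rewrite ve e3 => -[].
by apply/subset_leq_card/subsetP => u; rewrite !inE andbC.
Qed.

(** Expanding the square, the main terms [s * d ^+ 2] cancel. There remain [200 * delta] from
    [survival_pair] and [4 * (2 * delta)] from pairs of hyperedges with a further common vertex, as
    [lam ^+ 2 <= 4]. *)
Lemma variation (R : realFieldType) (V E : finType) (inc : E -> {set V})
    (A : {set V}) (w : E -> R) (delta : R) (L : nat) (v : V) (y s lam : R) :
    y = #|A|%:R^-1 -> s = (1 - y) ^+ L -> lam = s / (1 - 3 * y) ^+ L ->
    0 <= delta -> delta <= 1 / 200 -> spread inc A w delta -> v \in A ->
    16 <= #|A|%:R :> R -> L%:R * y <= 1 / 8 ->
  expect (round inc A w) (fun om : {ffun 'I_L -> _} => (survive inc om [set v])%:R *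
    (vdeg inc (thin inc w lam om) v - vdeg inc w v) ^+ 2) <= 208 * delta.
Proof.
move=> yE sE lamE delta0 delta1 sp vA A16 Lm; have [w0 supp d1 cod] := sp.
have A0 : A != set0 by apply/set0Pn; exists v.
have m0 : 0 < y by rewrite yE invr_gt0; lra.
have m16 : y <= 1 / 16 by rewrite yE div1r lef_pV2 // posrE; lra.
set d := vdeg inc w v; have d0 : 0 <= d by apply: sumr_ge0.
have s0 : 0 <= s by rewrite sE; apply: exprn_ge0; lra.
have s1 : s <= 1 by rewrite sE; apply: exprn_ile1; lra.
have t0 : 0 < (1 - 3 * y) ^+ L by apply: exprn_gt0; lra.
have lam0 : 0 <= lam by rewrite lamE divr_ge0 // ltW.
have lam2 : lam <= 2 by rewrite lamE sE; apply: survival_ratio => //; exact: ltW.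
have lamT := survival_pair (ltW m0) m16 Lm delta0 delta1; rewrite -sE -lamE in lamT.
pose sv (om : {ffun 'I_L -> E + V + unit}) (S : {set V}) : R := (survive inc om S)%:R.
have degE om : vdeg inc (thin inc w lam om) v
    = lam * \sum_(e | v \in inc e) w e * sv om (inc e).
  by rewrite /vdeg /thin mulr_sumr.
have svv om e : v \in inc e -> sv om [set v] * sv om (inc e) = sv om (inc e).
  move=> ve; rewrite /sv -natrM mulnb; congr (_%:R); congr (nat_of_bool _).
  rewrite -survive_setU; congr (survive _ _ _); apply/setUidPr.
  by rewrite sub1set.
have expand om : (survive inc om [set v])%:R *
    (vdeg inc (thin inc w lam om) v - d) ^+ 2
  = lam ^+ 2 * (\sum_(e | v \in inc e) \sum_(f | v \in inc f)
        w e * (w f * sv om (inc e :|: inc f)))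
    + (- (2 * d * lam)) * (\sum_(e | v \in inc e) w e * sv om (inc e))
    + d ^+ 2 * sv om [set v].
  have -> : \sum_(e | v \in inc e) \sum_(f | v \in inc f) w e * (w f * sv om (inc e :|: inc f))
      = (\sum_(e | v \in inc e) w e * sv om (inc e)) ^+ 2.
    rewrite expr2 mulr_suml; apply: eq_bigr => e ve; rewrite mulr_sumr.
    apply: eq_bigr => f vf; rewrite /sv survive_setU -mulnb natrM; ring.
  have svS : sv om [set v] * (\sum_(e | v \in inc e) w e * sv om (inc e))
      = \sum_(e | v \in inc e) w e * sv om (inc e).
    by rewrite mulr_sumr; apply: eq_bigr => e ve; rewrite mulrCA svv.
  rewrite degE -/(sv om _); set X := \sum_(e | _) _ in svS *.
  rewrite sqrrB mulrDr mulrBr [sv om _ * (lam * X) ^+ 2](_ : _ = (lam * X) ^+ 2); last first.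
    transitivity (lam * (sv om [set v] * X) * (lam * X)); first by ring.
    by rewrite svS; ring.
  rewrite [sv om _ * (lam * X * d *+ 2)](_ : _ = lam * (sv om [set v] * X) * d *+ 2); last first.
    by rewrite mulrnAr; congr (_ *+ 2); ring.
  by rewrite svS; ring.
have -> : expect (round inc A w) (fun om : {ffun 'I_L -> _} => (survive inc om [set v])%:R *
      (vdeg inc (thin inc w lam om) v - d) ^+ 2)
  = lam ^+ 2 * (\sum_(e | v \in inc e) \sum_(f | v \in inc f)
        w e * (w f * miss inc A w (inc e :|: inc f) ^+ L))
    + (- (2 * d * lam)) * (\sum_(e | v \in inc e) w e * miss inc A w (inc e) ^+ L)
    + d ^+ 2 * s.
  rewrite sE yE -(miss1 sp vA) -expect_survive.
  transitivity (expect (round inc A w) (fun om : {ffun 'I_L -> _} =>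
    lam ^+ 2 * (\sum_(e | v \in inc e) \sum_(f | v \in inc f)
        w e * (w f * sv om (inc e :|: inc f)))
    + (- (2 * d * lam)) * (\sum_(e | v \in inc e) w e * sv om (inc e))
    + d ^+ 2 * sv om [set v])).
    by apply: eq_bigr => om _; rewrite expand.
  rewrite !expectD !expectZ !expect_sum; congr (_ * _ + _ * _ + _).
    apply: eq_bigr => e ve; rewrite expect_sum; apply: eq_bigr => f vf.
    by rewrite !expectZ expect_survive.
  by apply: eq_bigr => e ve; rewrite expectZ expect_survive.
have first_order : s * d <= lam * \sum_(e | v \in inc e) w e * miss inc A w (inc e) ^+ L.
  rewrite -[s](divfK (lt0r_neq0 t0)) -lamE -mulrA ler_wpM2l // /d /vdeg mulr_sumr.
  apply: ler_sum => e ve; rewrite mulrC; have := w0 e; rewrite le_eqVlt => /orP[/eqP<-|we].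
    by rewrite !mul0r.
  have [eA e3] := supp e we; rewrite ler_wpM2l // lerXn2r ?nnegrE ?(miss_ge0 _ sp) //; first by lra.
  by have := miss_ge sp A0 eA; rewrite e3 -yE.
have second_order : \sum_(e | v \in inc e) \sum_(f | v \in inc f)
    w e * (w f * miss inc A w (inc e :|: inc f) ^+ L)
    <= d * (d * (1 - 5 * y + 25 * delta * y) ^+ L + 2 * delta).
  rewrite {1}/d /vdeg mulr_suml; apply: ler_sum => e ve; rewrite -mulr_sumr.
  have := w0 e; rewrite le_eqVlt => /orP[/eqP<-|we]; first by rewrite !mul0r.
  by rewrite ler_wpM2l // yE; exact: expect_pair.
have lam4 : lam ^+ 2 <= 4 by nra.
have dd : d <= 1 by exact: d1.
have h1 := ler_wpM2l (exprn_ge0 2 lam0) second_order.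
have h2 := ler_wpM2l (mulr_ge0 d0 d0) lamT.
have h3 := ler_wpM2r (mulr_ge0 d0 delta0) lam4.
have h4 := ler_wpM2l d0 first_order.

move: h1 h2 h3 h4; set T5 := (1 - 5 * y + 25 * delta * y) ^+ L.
set S2 := \sum_(e | _) _; set S1 := \sum_(e | _) _ => h1 h2 h3 h4.
have h5 : s * (d * d) <= 1 by apply: mulr_ile1 => //; [exact: mulr_ge0|exact: mulr_ile1].
have h6 : s * (d * d) * delta <= delta by rewrite ler_piMl.
have h7 : d * delta <= delta by rewrite ler_piMl.
clear -h1 h2 h3 h4 h6 h7; lra.
Qed.

(** * The nibble step and its iteration *)

(** The loss is measured per vertex of [A], so it shrinks by itself when the survivors replace
    [A]. *)
Definition nibble_bound (R : realFieldType) (alpha : R) : Prop :=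
  exists2 delta : R, 0 < delta &
  forall (V E : finType) (inc : E -> {set V}) (A : {set V}) (w : E -> R),
    spread inc A w delta ->
  exists M : {set E}, [/\ forall e, e \in M -> 0 < w e,
    forall e f, e \in M -> f \in M -> e != f -> [disjoint inc e & inc f] &
    \sum_e w e - alpha * #|A|%:R <= #|M|%:R].

Definition picked (R : realFieldType) (V E : finType) (inc : E -> {set V}) (w : E -> R)
    (L : nat) (om : {ffun 'I_L -> E + V + unit}) : {set E} :=
  [set e | (0 < w e) && [exists i, isolated inc om e i]].

Definition survivors (V E : finType) (inc : E -> {set V}) (A : {set V})
    (L : nat) (om : {ffun 'I_L -> E + V + unit}) : {set V} :=
  [set v in A | survive inc om [set v]].

(** A hyperedge is isolated in at most one round, so being picked is a sum over rounds; the factor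
    [1 - 3 * (L%:R * y)] is the union bound for its three vertices to stay unhit. *)
Lemma expect_picked (R : realFieldType) (V E : finType) (inc : E -> {set V})
    (A : {set V}) (w : E -> R) (delta : R) (L : nat) (y : R) :
    y = #|A|%:R^-1 -> y <= 1 / 16 -> spread inc A w delta -> A != set0 ->
  L%:R * y * (1 - 3 * (L%:R * y)) * \sum_e w e <=
  expect (round inc A w) (fun om : {ffun 'I_L -> _} => #|picked inc w om|%:R).
Proof.
move=> yE y16 sp A0; have [w0 supp _ _] := sp.
have y0 : 0 <= y by rewrite yE invr_ge0 ler0n.
apply: (@le_trans _ _ (expect (round inc A w) (fun om : {ffun 'I_L -> _} =>
    \sum_(e | 0 < w e) \sum_i (isolated inc om e i)%:R))); last first.
  apply: le_expect => [x|om]; first exact: (round_ge0 _ sp).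
  rewrite -sumr_const big_mkcond [leRHS]big_mkcond; apply: ler_sum => e _.
  rewrite inE; case: ifP => // we /=.
  have [/existsP[i iso]|none] := boolP [exists i, isolated inc om e i].
    rewrite (bigD1 i) //= iso big1 ?addr0 // => j ji.
    case: (boolP (isolated _ _ _ _)) => // iso'.
    have e0 : inc e != set0 by rewrite -cards_eq0 (supp e we).2.
    by rewrite (isolated_uniq e0 iso iso') eqxx in ji.
  rewrite big1 // => i _; case: (boolP (isolated _ _ _ _)) => // iso.
  by move: none; rewrite negb_exists => /forallP/(_ i); rewrite iso.
rewrite expect_sum mulr_sumr [leLHS](bigID (fun e => 0 < w e)) /=.
rewrite [X in _ + X]big1 ?addr0 => [|e]; last first.
  by rewrite -leNgt => we; have -> : w e = 0 by [apply/eqP; rewrite eq_le we w0|]; rewrite mulr0.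
apply: ler_sum => e we; rewrite expect_sum.
apply: (@le_trans _ _ (\sum_(i < L) w e * y * (1 - 3 * (L%:R * y)))).
  rewrite sumr_const card_ord -[_ *+ L]mulr_natl le_eqVlt; apply/orP; left; apply/eqP.
  by ring.
apply: ler_sum => i _; apply: le_trans (expect_isolated _ _ sp A0); rewrite -yE.
rewrite ler_wpM2l ?mulr_ge0 //.
have [eA e3] := supp e we; have := miss_ge sp A0 eA; rewrite e3 -yE => q3.
apply: le_trans (lerXn2r L _ _ q3); rewrite ?nnegrE ?(miss_ge0 _ sp) //; last by lra.
by apply: le_trans (bernoulli L _ _); lra.
Qed.

(** With x = d' - 1 > 0 the left side is x + x^2, where [x <= theta + x^2 / (4 * theta)] and
    [x <= d' - d]. It turns the loss by trimming into a second moment. *)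
Lemma excess_bound (R : realFieldType) (d d' theta : R) : 0 < theta -> d <= 1 -> 0 <= d' ->
  d' * Num.max 0 (d' - 1) <= theta + (1 + 1 / (4 * theta)) * (d' - d) ^+ 2.
Proof.
move=> th0 d1 d'0; have k0 : 0 < 1 / (4 * theta) by rewrite divr_gt0 // mulr_gt0.
have k1 : 1 / (4 * theta) * (4 * theta) = 1 by rewrite divfK // lt0r_neq0 // mulr_gt0.
have sq := sqr_ge0 (d' - d).
have [le1|gt1] := lerP (d' - 1) 0.
  by rewrite mulr0; have := mulr_ge0 (ltW k0) sq; lra.
have le2 : (d' - 1) ^+ 2 <= (d' - d) ^+ 2 by rewrite lerXn2r ?nnegrE; lra.
set k := 1 / (4 * theta) in k0 k1 *.
have h1 := ler_wpM2l (ltW k0) le2.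
have h2 : 0 <= k * (d' - 1 - 2 * theta) ^+ 2 by rewrite mulr_ge0 ?sqr_ge0 ?ltW.
have h3 : k * theta = 1 / 4 by lra.
have h4 : k * theta * (d' - 1) = 1 / 4 * (d' - 1) by rewrite h3.
have h5 : k * theta * theta = 1 / 4 * theta by rewrite h3.
by lra.
Qed.

(** The choice of [lam] makes the mean thinned weight at least [s] times the total; [excess_bound]
    and [variation] limit what trimming costs at each vertex. *)
Lemma expect_trim (R : realFieldType) (V E : finType) (inc : E -> {set V})
    (A : {set V}) (w : E -> R) (delta theta : R) (L : nat) (y s lam : R) :
    y = #|A|%:R^-1 -> s = (1 - y) ^+ L -> lam = s / (1 - 3 * y) ^+ L ->
    0 <= delta -> delta <= 1 / 200 -> 0 < theta -> spread inc A w delta ->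
    16 <= #|A|%:R :> R -> L%:R * y <= 1 / 8 ->
  s * (\sum_e w e) - #|A|%:R * (theta + (1 + 1 / (4 * theta)) * (208 * delta)) <=
  expect (round inc A w) (fun om : {ffun 'I_L -> _} =>
    \sum_e trim inc (thin inc w lam om) e).
Proof.
move=> yE sE lamE delta0 delta1 th0 sp A16 Lm; have [w0 supp d1 _] := sp.
have A0 : A != set0.
  by rewrite -cards_eq0 -(pnatr_eq0 R); apply/eqP => A0; move: A16; rewrite A0; lra.
have y0 : 0 < y by rewrite yE invr_gt0; lra.
have y16 : y <= 1 / 16 by rewrite yE div1r lef_pV2 // posrE; lra.
have t0 : 0 < (1 - 3 * y) ^+ L by apply: exprn_gt0; lra.
have s0 : 0 <= s by rewrite sE; apply: exprn_ge0; lra.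
have lam0 : 0 <= lam by rewrite lamE divr_ge0 // ltW.
have k0 : 0 < 1 / (4 * theta) by rewrite divr_gt0 // mulr_gt0.
pose K := 1 + 1 / (4 * theta).
have K0 : 0 <= K by rewrite addr_ge0 // ltW.
have thin0 (om : {ffun 'I_L -> E + V + unit}) e : 0 <= thin inc w lam om e.
  by rewrite /thin !mulr_ge0 ?ler0n.
have mu0 x : 0 <= round inc A w x by exact: (round_ge0 _ sp).
pose sv (om : {ffun 'I_L -> E + V + unit}) v : R := (survive inc om [set v])%:R.
apply: (@le_trans _ _ (expect (round inc A w) (fun om : {ffun 'I_L -> _} =>
    lam * (\sum_e w e * (survive inc om (inc e))%:R) + \sum_(v in A) (- theta +
      (- K) * (sv om v * (vdeg inc (thin inc w lam om) v - vdeg inc w v) ^+ 2))))).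
  rewrite expectD; apply: lerD.
    rewrite expectZ expect_sum -[s](divfK (lt0r_neq0 t0)) -lamE -mulrA ler_wpM2l //.
    rewrite mulr_sumr; apply: ler_sum => e _; rewrite expectZ expect_survive mulrC.
    have := w0 e; rewrite le_eqVlt => /orP[/eqP<-|we]; first by rewrite !mul0r.
    have [eA e3] := supp e we.
    rewrite ler_wpM2l // lerXn2r ?nnegrE ?(miss_ge0 _ sp) //; first by lra.
    by have := miss_ge sp A0 eA; rewrite e3 -yE.
  rewrite expect_sum -mulrN [#|A|%:R * _]mulr_natl -sumr_const; apply: ler_sum => v vA.
  rewrite expectD expectZ (expect_cst _ _ (sum_round1 sp A0)) opprD lerD2l -mulNr.
  rewrite ler_wnM2l ?oppr_le0 //.
  exact: (variation yE sE lamE).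
apply: le_expect => // om; apply: le_trans _ (sum_trim inc (thin0 om)); apply: lerD.
  by rewrite mulr_sumr.
rewrite -sumrN big_mkcond; apply: ler_sum => v _; case: ifP => vA; last first.
  rewrite /vdeg big1 ?mul0r ?oppr0 // => e ve; rewrite /thin.
  have := w0 e; rewrite le_eqVlt => /orP[/eqP<-|/supp[eA _]]; first by rewrite mul0r mulr0.
  by have := subsetP eA v ve; rewrite vA.
rewrite mulNr -opprD lerN2 /sv; have [alive|dead] := boolP (survive inc om [set v]).
  by rewrite mul1r excess_bound //; apply: sumr_ge0.
rewrite mul0r mulr0 addr0 /vdeg big1 ?mul0r ?ltW // => e ve; rewrite /thin.
suff -> : survive inc om (inc e) = false by rewrite !mulr0.
by apply: contraNF dead; apply: survive_sub; rewrite sub1set.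
Qed.

Lemma expect_survivors (R : realFieldType) (V E : finType) (inc : E -> {set V})
    (A : {set V}) (w : E -> R) (delta : R) (L : nat) (y : R) :
    y = #|A|%:R^-1 -> spread inc A w delta ->
  expect (round inc A w) (fun om : {ffun 'I_L -> _} => #|survivors inc A om|%:R)
    = #|A|%:R * (1 - y) ^+ L.
Proof.
move=> yE sp; transitivity (expect (round inc A w) (fun om : {ffun 'I_L -> _} =>
    \sum_(v in A) (survive inc om [set v])%:R)).
  apply: eq_bigr => om _; congr (_ * _); rewrite -sumr_const big_mkcond [RHS]big_mkcond.
  by apply: eq_bigr => v _; rewrite inE; case: (v \in A); case: survive.
rewrite expect_sum mulr_natl -sumr_const; apply: eq_bigr => v vA.
by rewrite expect_survive (miss1 sp vA) yE.
Qed.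

Lemma spread_survivors (R : realFieldType) (V E : finType) (inc : E -> {set V})
    (A : {set V}) (w : E -> R) (delta lam : R) (L : nat)
    (om : {ffun 'I_L -> E + V + unit}) :
    0 <= lam -> lam <= 2 -> 0 <= delta -> spread inc A w delta ->
  spread inc (survivors inc A om) (trim inc (thin inc w lam om)) (2 * delta).
Proof.
move=> lam0 lam2 delta0 [w0 supp d1 cod].
have thin0 e : 0 <= thin inc w lam om e by rewrite /thin !mulr_ge0 ?ler0n.
have trim_thin e : trim inc (thin inc w lam om) e <= thin inc w lam om e by exact: trim_le.
split.
- by move=> e; exact: trim_ge0.
- move=> e /lt_le_trans/(_ (trim_thin e)); rewrite /thin.
  have [alive|_] := boolP (survive inc om (inc e)); last by rewrite !mulr0 ltxx.
  have := w0 e; rewrite le_eqVlt => /orP[/eqP<-|/supp[eA e3] _].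
    by rewrite mul0r mulr0 ltxx.
  split=> //; apply/subsetP => v ve; rewrite inE (subsetP eA) //.
  by apply: survive_sub alive; rewrite sub1set.
- by move=> v; exact: vdeg_trim.
move=> u v uv; apply: (@le_trans _ _ (2 * vcodeg inc w u v)); last first.
  by rewrite ler_wpM2l // cod.
rewrite /vcodeg mulr_sumr; apply: ler_sum => e _; apply: le_trans (trim_thin e) _.
rewrite /thin; apply: ler_pM => //; first by rewrite mulr_ge0 ?ler0n.
by rewrite -[leRHS]mulr1 ler_wpM2l // lern1 leq_b1.
Qed.

(** Hyperedges of the later matching survive all rounds, so they avoid every hyperedge chosen in a
    round. *)
Lemma combine_rounds (R : realFieldType) (V E : finType) (inc : E -> {set V})
    (A : {set V}) (w : E -> R) (delta : R) (L : nat)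
    (om : {ffun 'I_L -> E + V + unit}) (M1 : {set E}) :
    spread inc A w delta ->
    (forall e, e \in M1 -> 0 < w e /\ survive inc om (inc e)) ->
    (forall e f, e \in M1 -> f \in M1 -> e != f -> [disjoint inc e & inc f]) ->
  let M := picked inc w om :|: M1 in
  [/\ forall e, e \in M -> 0 < w e,
      forall e f, e \in M -> f \in M -> e != f -> [disjoint inc e & inc f] &
      #|M| = (#|picked inc w om| + #|M1|)%N].
Proof.
move=> [_ supp _ _] M1w M1d M.
have pickedP e : e \in picked inc w om -> 0 < w e /\ exists i, isolated inc om e i.
  by rewrite inE => /andP[-> /existsP].
have cross e f : e \in picked inc w om -> f \in M1 -> [disjoint inc e & inc f].
  move=> /pickedP[_ [i /isolatedP[omi _]]] /M1w[_ /forallP/(_ i)].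
  by rewrite omi.
split.
- by move=> e; rewrite inE => /orP[/pickedP[]|/M1w[]].
- move=> e f; rewrite [e \in M]inE [f \in M]inE => /orP[eP|eM] /orP[fP|fM] ef.
  + have [_ [i /isolatedP[omi _]]] := pickedP e eP.
    have [_ [j /isolatedP[omj dj]]] := pickedP f fP.
    have ij : i != j by apply: contraNneq ef => ij; move: omj; rewrite -ij omi => -[->].
    by have := dj i ij; rewrite omi.
  + exact: cross.
  + by rewrite disjoint_sym; exact: cross.
  + exact: M1d.
rewrite cardsU [_ :&: _](_ : _ = set0) ?cards0 ?subn0 //.
apply/setP => e; rewrite inE [RHS]inE; apply/negbTE; rewrite negb_and -implybE.
apply/implyP => eP; apply/negP => /(cross _ _ eP); rewrite -setI_eq0 setIid.
by rewrite -cards_eq0 (supp e (pickedP e eP).1).2.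
Qed.

Lemma round_count (R : realFieldType) (alpha : R) (m : nat) :
    0 < alpha -> alpha <= 1 -> 16 <= alpha * m%:R ->
  exists L : nat, alpha / 16 <= L%:R / m%:R /\ L%:R / m%:R <= alpha / 8.
Proof.
move=> a0 a1 big; have m0 : 0 < (m%:R : R) by nra.
have exL : exists L, 8 * (L%:R : R) <= alpha * m%:R by exists 0%N; lra.
have bound L : 8 * (L%:R : R) <= alpha * m%:R -> (L <= m)%N.
  move=> le8; rewrite -(ler_nat R); have := ler0n R L; nra.
case: (ex_maxnP exL bound) => L le8 maxL; exists L.
rewrite ler_pdivlMr // ler_pdivrMr //; split; last by lra.
rewrite leNgt; apply/negP => lt; have : (L.+1 <= L)%N.
  by apply: maxL; rewrite -natr1; lra.
by rewrite ltnn.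
Qed.

(** Passing to [s * m] survivors saves about [alpha * x * m] of the allowed loss. Collisions and the
    square term in [s] cost at most a quarter of this, as [x <= alpha / 8]. Half of it, by
    [alpha / 16 <= x], pays for [err] and the improvement of [alpha]. *)
Lemma nibble_gain (R : realFieldType) (alpha x s W m err : R) :
    0 < alpha -> alpha <= 1 -> alpha / 16 <= x -> x <= alpha / 8 ->
    1 - x <= s -> s <= 1 - x + x ^+ 2 -> 0 <= W -> 3 * W <= m ->
    err <= alpha ^+ 2 / 64 ->
  W - (alpha - alpha ^+ 2 / 64) * m <=
    x * (1 - 3 * x) * W + (s * W - m * err) - alpha * (m * s).
Proof.
move=> a0 a1 x1 x2 s1 s2 W0 W3 err1; have m0 : 0 <= m by lra.
have x0 : 0 <= x by lra.
have h1 := ler_wpM2r W0 s1.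
have h2 := ler_wpM2r (mulr_ge0 (ltW a0) m0) s2.
have h3 := ler_wpM2r m0 err1.
have h4 := ler_wpM2l (mulr_ge0 x0 x0) W3.
have h5 : alpha * m * (alpha / 16) <= alpha * m * x.
  by apply: ler_wpM2l => //; rewrite mulr_ge0 // ltW.
have h6 : m * (x * x) <= m * (x * (alpha / 8)).
  by apply: ler_wpM2l => //; apply: ler_wpM2l.
have h7 : m * (x * x) * alpha <= m * (x * x) * 1.
  by apply: ler_wpM2l => //; rewrite !mulr_ge0.
have h8 : 0 <= alpha * m * x by rewrite !mulr_ge0 // ltW.
by lra.
Qed.

Lemma nibble_step (R : realFieldType) (alpha : R) : 0 < alpha -> alpha <= 1 ->
  nibble_bound alpha -> nibble_bound (alpha - alpha ^+ 2 / 64).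
Proof.
move=> a0 a1 [delta1 delta1_gt0 IH].
pose theta := alpha ^+ 2 / 128; pose K := 1 + 1 / (4 * theta).
have a2 : alpha ^+ 2 <= alpha by nra.
have th0 : 0 < theta by rewrite divr_gt0 // exprn_gt0.
have th1 : theta <= 1 / 128 by rewrite /theta; lra.
have K1 : 1 <= K by rewrite lerDl divr_ge0 // mulr_ge0 // ltW.
(* Codegrees may double in a step, since [lam <= 2]; the second bound keeps the trimming error below
   [2 * theta = alpha ^+ 2 / 64]. *)
pose delta := Num.min (delta1 / 2) (theta / (208 * K)).
have K0 : 0 < K by apply: lt_le_trans K1.
have delta0 : 0 < delta by rewrite lt_min !divr_gt0 // mulr_gt0.
have d_delta1 : 2 * delta <= delta1.
  have : delta <= delta1 / 2 by rewrite ge_min lexx.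
  by lra.
have dK : K * (208 * delta) <= theta.
  have : delta <= theta / (208 * K) by rewrite ge_min lexx orbT.
  by rewrite ler_pdivlMr; lra.
have d208 : 208 * delta <= theta by apply: le_trans dK; nra.
exists delta => // V E inc A w sp; have [w0 supp d1 cod] := sp.
set m := #|A|; set W := \sum_e w e.
have W0 : 0 <= W by apply: sumr_ge0.
have m0 : 0 <= (m%:R : R) by exact: ler0n.
have [big|small] := lerP 16 (alpha * m%:R); last first.
  (* With fewer than [16 / alpha] vertices the codegree bound makes the whole weight smaller than
     the allowed loss. *)
  exists set0; split; try by move=> e; rewrite inE.
  rewrite cards0 subr_le0; have := sum_vcodeg (ltW delta0) sp; rewrite -/m -/W => W6.
  have h1 : m%:R * alpha * (m%:R * delta) <= 16 * (m%:R * delta).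
    by apply: ler_wpM2r; [rewrite mulr_ge0 // ltW|lra].
  have h2 : m%:R * (16 * delta) <= m%:R * (alpha ^+ 2 / 8).
    by apply: ler_wpM2l => //; rewrite /theta in d208; have := sqr_ge0 alpha; lra.
  have h3 : m%:R * (alpha ^+ 2) <= m%:R * alpha by apply: ler_wpM2l.
  have h4 : alpha * (6 * W) <= alpha * (m%:R ^+ 2 * delta) by apply: ler_wpM2l => //; exact: ltW.
  have h5 : alpha * W <= alpha * (alpha * m%:R / 48) by lra.
  have : W <= alpha * m%:R / 48 by rewrite -(ler_pM2l a0).
  by have := mulr_ge0 (ltW a0) m0; lra.
have m16 : 16 <= (m%:R : R) by nra.
have [L [x1 x2]] := round_count a0 a1 big.
set y := (m%:R : R)^-1 in x1 x2 *; set x := L%:R * y in x1 x2.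
have y0 : 0 < y by rewrite invr_gt0; lra.
have y16 : y <= 1 / 16 by rewrite div1r lef_pV2 // posrE; lra.
have A0 : A != set0.
  by rewrite -cards_eq0 -/m -(pnatr_eq0 R); apply/eqP => A0; move: m16; rewrite A0; lra.
pose s := (1 - y) ^+ L; pose lam := s / (1 - 3 * y) ^+ L.
have x8 : L%:R * y <= 1 / 8 by rewrite -/x; lra.
have lam2 : lam <= 2 by apply: survival_ratio => //; exact: ltW.
have lam0 : 0 <= lam by rewrite divr_ge0 ?exprn_ge0 //; lra.
have s1 : 1 - x <= s by apply: bernoulli; lra.
have s2 : s <= 1 - x + x ^+ 2 by apply: exp_le_quadratic; lra.
have d200 : delta <= 1 / 200 by lra.
have W3 : 3 * W <= m%:R.
  rewrite -(sum_vdeg sp) -sumr_const; apply: ler_sum => v _; exact: d1.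
have err : theta + K * (208 * delta) <= alpha ^+ 2 / 64 by rewrite /theta in dK *; lra.
have gain := nibble_gain a0 a1 x1 x2 s1 s2 W0 W3 err.
have [om] : exists om : {ffun 'I_L -> E + V + unit},
    W - (alpha - alpha ^+ 2 / 64) * m%:R <= #|picked inc w om|%:R
      + \sum_e trim inc (thin inc w lam om) e + - alpha * #|survivors inc A om|%:R.
  apply: (expect_exists (mu := round inc A w)) (sum_round1 sp A0) _.
    by move=> z; exact: (round_ge0 _ sp).
  rewrite !expectD expectZ (expect_survivors _ (erefl y) sp); apply: le_trans gain _.
  rewrite mulNr; apply: lerB => //; apply: lerD.
    exact: (expect_picked _ (erefl y) y16 sp A0).
  exact: (expect_trim (erefl y) (erefl s) (erefl lam) (ltW delta0) d200 th0 sp m16 x8).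
have sp' := spread_survivors om lam0 lam2 (ltW delta0) sp.
have {}sp' : spread inc (survivors inc A om) (trim inc (thin inc w lam om)) delta1.
  have [t0 tsupp td tcod] := sp'; split=> // u v uv; exact: le_trans (tcod u v uv) d_delta1.
have [M1 [M1w M1d M1c]] := IH _ _ _ _ _ sp'.
have M1s e : e \in M1 -> 0 < w e /\ survive inc om (inc e).
  move=> /M1w te; have th : 0 < thin inc w lam om e.
    apply: lt_le_trans te _; apply: trim_le; apply: mulr_ge0 => //.
    by apply: mulr_ge0; rewrite ?ler0n.
  move: th; rewrite /thin; case: (survive inc om (inc e)); last by rewrite !mulr0 ltxx.
  rewrite mulr1 => lw; split=> //; rewrite lt0r w0 andbT.
  by apply: contraTneq lw => ->; rewrite mulr0 ltxx.
have [Mw Md Mc] := combine_rounds sp M1s M1d.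
move=> le_om; exists (picked inc w om :|: M1); split=> //.
by rewrite Mc natrD; move: le_om M1c; clear; lra.
Qed.

Lemma nibble_bound_le (R : realFieldType) (alpha beta : R) :
  alpha <= beta -> nibble_bound alpha -> nibble_bound beta.
Proof.
move=> ab [delta d0 IH]; exists delta => // V E inc A w sp.
have [M [M1 M2 M3]] := IH V E inc A w sp; exists M; split=> //.
by apply: le_trans M3; rewrite lerD2l lerN2 ler_wpM2r.
Qed.

Lemma nibble_bound1 (R : realFieldType) : nibble_bound (1 : R).
Proof.
exists 1 => // V E inc A w sp; have [w0 _ d1 _] := sp.
exists set0; split; try by move=> e; rewrite inE.
rewrite cards0 mul1r subr_le0; have := sum_vdeg sp.
have : \sum_(v in A) vdeg inc w v <= #|A|%:R.
  by rewrite -sumr_const; apply: ler_sum => v _; exact: d1.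
have : 0 <= \sum_e w e by apply: sumr_ge0.
by clear; lra.
Qed.

(** As long as the current loss is at least [alpha], a step lowers it by at least the fixed amount
    [alpha ^+ 2 / 64]. *)
Lemma nibble_all (R : archiRealFieldType) (alpha : R) : 0 < alpha -> nibble_bound alpha.
Proof.
move=> a0; have [a1|a1] := lerP 1 alpha.
  exact: nibble_bound_le a1 (nibble_bound1 R).
have g0 : 0 < alpha ^+ 2 / 64 by rewrite divr_gt0 // exprn_gt0.
suff step k : nibble_bound (Num.max alpha (1 - k%:R * (alpha ^+ 2 / 64))).
  have := step (Num.bound (1 / (alpha ^+ 2 / 64))).
  rewrite max_l //; have := archi_boundP (ltW (divr_gt0 ltr01 g0)).
  by rewrite ltr_pdivrMr // => h; lra.
elim: k => [|k IHk].
  by apply: nibble_bound_le (nibble_bound1 R); rewrite mul0r subr0 le_max lexx orbT.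
set beta := Num.max _ _ in IHk.
have ab : alpha <= beta by rewrite le_max lexx.
have b1 : beta <= 1.
  by rewrite ge_max (ltW a1) gerBl mulr_ge0 // ltW.
apply: nibble_bound_le (nibble_step (lt_le_trans a0 ab) b1 IHk).
have sq : alpha ^+ 2 / 64 <= beta ^+ 2 / 64.
  rewrite ler_wpM2r ?invr_ge0 // lerXn2r ?nnegrE //; first exact: ltW.
  exact: ltW (lt_le_trans a0 ab).
have [ge|lt] := lerP (1 - k%:R * (alpha ^+ 2 / 64)) alpha.
  rewrite le_max; apply/orP; left; rewrite /beta max_l //.
  by rewrite gerBl ltW.
rewrite le_max; apply/orP; right; rewrite -[k.+1%:R]natr1.
have bE : beta = 1 - k%:R * (alpha ^+ 2 / 64) by rewrite /beta max_r // ltW.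
by rewrite mulrDl mul1r opprD addrA -bE lerD2l lerN2.
Qed.

(** * From fractional to integral packings *)

Lemma card_supersets n k (S : {set 'I_n}) : (#|S| <= k)%N ->
  #|[set A : {set 'I_n} | (S \subset A) && (#|A| == k)]| = 'C(n - #|S|, k - #|S|).
Proof.
move=> Sk; have cS : #|~: S| = (n - #|S|)%N by rewrite cardsCs setCK card_ord.
rewrite -cS -cards_draws.
rewrite -[RHS](card_in_imset (f := fun B => S :|: B)); last first.
  move=> B B'; rewrite !inE => /andP[BS _] /andP[B'S _] /(congr1 (fun X => X :\: S)).
  by rewrite !setDUl setDv !set0U !setDE (setIidPl BS) (setIidPl B'S).
apply: eq_card => A; apply/idP/imsetP.
  rewrite inE => /andP[SA /eqP Ak]; exists (A :\: S); last first.
    by rewrite -{1}(setID A S) (setIidPr SA).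
  by rewrite inE setDE subsetIr -setDE cardsD (setIidPr SA) Ak eqxx.
move=> [B]; rewrite inE => /andP[BS /eqP Bk] ->; rewrite inE subsetUl /=.
rewrite cardsU Bk (_ : S :&: B = set0) ?cards0 ?subn0 ?subnKC //.
by apply/eqP; rewrite setIC setI_eq0 disjoints_subset.
Qed.

Lemma packing_le1 (R : realFieldType) n (c : colouring n) (S T : {set 'I_n})
    (w : {set 'I_n} -> R) : fractional_packing c S w -> w T <= 1.
Proof.
move=> [w0 w_out pack]; have [Tm|/w_out->] := boolP (T \in mono_triangles c S); last exact: ler01.
have [u [v [x [_ [uv _ _] TE _ _]]]] := mono_triangleP Tm.
apply: le_trans (pack [set u; v] _); last by rewrite cards2 uv.
rewrite (bigD1 T) /=; last by rewrite TE subsetUl.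
by rewrite lerDl sumr_ge0.
Qed.

(** The divisor is the number of [k]-sets through a given edge, not the number of all [k]-sets, so
    that edge loads stay at most 1. *)
Definition average_packing (R : realFieldType) n (k : nat)
    (W : {set 'I_n} -> {set 'I_n} -> R) (T : {set 'I_n}) : R :=
  (\sum_(A : {set 'I_n} | #|A| == k) W A T) / 'C(n - 2, k - 2)%:R.

Lemma average_spread (R : realFieldType) n (c : colouring n) (k : nat)
    (W : {set 'I_n} -> {set 'I_n} -> R) (delta : R) :
    (3 <= k)%N -> (k <= n)%N -> (k - 2)%:R <= delta * (n - 2)%:R ->
    (forall A, fractional_packing c A (W A)) ->
  spread (@edges n) (edges setT) (average_packing k W) delta.
Proof.
move=> k3 kn le_delta packW; set D := 'C(n - 2, k - 2)%:R : R.
have D0 : 0 < D by rewrite ltr0n bin_gt0 leq_sub2r.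
have W0 A T : 0 <= W A T by case: (packW A).
have W_out A T : T \notin mono_triangles c A -> W A T = 0 by case: (packW A) => _ + _; exact.
have avg0 T : 0 <= average_packing k W T.
  by apply: divr_ge0; [exact: sumr_ge0|exact: ltW].
have posW T : 0 < average_packing k W T -> exists A, T \in mono_triangles c A.
  move=> pos; apply/existsP; apply: contraTT pos; rewrite negb_exists => /forallP noA.
  by rewrite /average_packing big1 ?mul0r ?ltxx // => A _; exact: W_out (noA A).
have card3 T : 0 < average_packing k W T -> #|T| = 3%N.
  by move=> /posW[A]; rewrite inE => /and3P[_ /eqP].
split=> //.
- move=> T /card3 T3; rewrite card_edges T3; split=> //.
  by apply/subsetP => e; rewrite !inE subsetT => /andP[].
- move=> e; rewrite /vdeg; have [e2|e2] := boolP (#|e| == 2); last first.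
    by rewrite big_pred0 ?ler01 // => T; rewrite inE (negPf e2) andbF.
  rewrite (eq_bigl (fun T : {set 'I_n} => e \subset T)); last first.
    by move=> T; rewrite inE e2 andbT.
  rewrite /average_packing -mulr_suml ler_pdivrMr // mul1r exchange_big /=.
  have DE : D = \sum_(A : {set 'I_n} | (e \subset A) && (#|A| == k)) 1.
    have := @card_supersets n k e; rewrite (eqP e2) => /(_ (ltnW k3)).
    by rewrite cardsE sumr_const /D => <-.
  rewrite -/D DE.
  rewrite (bigID (fun A : {set 'I_n} => e \subset A)) /= [X in _ + X]big1 ?addr0.
    rewrite [leRHS](eq_bigl (fun A : {set 'I_n} => (#|A| == k) && (e \subset A))).
      by apply: ler_sum => A _; have [_ _ pack] := packW A; exact: pack.
    by move=> A; rewrite andbC.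
  move=> A /andP[_ eA]; rewrite big1 // => T eT; apply: W_out.
  by rewrite inE; apply: contra eA => /andP[TA _]; exact: subset_trans eT TA.
move=> e f ef; rewrite /vcodeg.
have le1 T : average_packing k W T <= delta.
  have [->|pos] := eqVneq (average_packing k W T) 0.
    rewrite -(pmulr_lge0 _ (_ : 0 < (n - 2)%:R)) ?(le_trans _ le_delta) ?ler0n //.
    by rewrite ltr0n subn_gt0; apply: leq_trans kn.
  have {}pos : 0 < average_packing k W T by rewrite lt0r pos avg0.
  have T3 := card3 T pos; rewrite /average_packing ler_pdivrMr //.
  apply: (@le_trans _ _ 'C(n - 3, k - 3)%:R).
    have := @card_supersets n k T; rewrite T3 => /(_ k3) <-.
    rewrite -sumr_const (bigID (fun A : {set 'I_n} => T \subset A)) /= [X in _ + X]big1 ?addr0.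
      rewrite [leRHS](eq_bigl (fun A : {set 'I_n} => (#|A| == k) && (T \subset A))).
        by apply: ler_sum => A _; exact: packing_le1 (packW A).
      by move=> A; rewrite inE andbC.
    by move=> A /andP[_ TA]; apply: W_out; rewrite inE (negPf TA).
  have := mul_bin_diag (n - 2) (k - 3).
  have -> : (n - 2).-1 = (n - 3)%N by rewrite -subn1 -subnDA.
  have -> : (k - 3).+1 = (k - 2)%N by rewrite -subSn.
  move=> /(congr1 (fun x => x%:R : R)); rewrite !natrM => binE.
  have n2 : 0 < ((n - 2)%:R : R) by rewrite ltr0n subn_gt0; apply: leq_trans kn.
  rewrite -(ler_pM2l n2) binE -/D; apply: le_trans (ler_wpM2r (ltW D0) le_delta) _.
  by rewrite mulrA [delta * _]mulrC.
rewrite (bigID (pred1 (e :|: f))) /= [X in _ + X]big1 ?addr0.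
  apply: (@le_trans _ _ (\sum_(T | T == e :|: f) average_packing k W T)).
    rewrite [leLHS]big_mkcondl; apply: ler_sum => T _.
    by case: ifP => // _; exact: avg0.
  by rewrite big_pred1_eq.
move=> T /andP[/andP[eT fT] nT]; apply/eqP; apply: contraNT nT => pos.
have T3 : #|T| = 3%N by apply: card3; rewrite lt0r pos avg0.
move: eT fT; rewrite !inE => /andP[eT e2] /andP[fT f2].
rewrite eq_sym eqEcard subUset eT fT T3 /=.
suff: e \proper e :|: f by move/proper_card; rewrite (eqP e2).
rewrite properE subsetUl /= subUset subxx /=; apply: contra ef => fe.
by rewrite eq_sym eqEcard fe (eqP e2) (eqP f2).
Qed.

(** The density [g] carries over because [n(n-1) C(n-2, k-2) = k(k-1) C(n, k)]. *)
Lemma sum_average (R : realFieldType) n (k : nat)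
    (W : {set 'I_n} -> {set 'I_n} -> R) (g : R) :
    (2 <= k)%N -> (k <= n)%N ->
    (forall A : {set 'I_n}, #|A| = k -> k%:R * (k%:R - 1) * g <= \sum_T W A T) ->
  n%:R * (n%:R - 1) * g <= \sum_T average_packing k W T.
Proof.
move=> k2 kn le_g; set D := 'C(n - 2, k - 2)%:R : R.
have D0 : 0 < D by rewrite ltr0n bin_gt0 leq_sub2r.
rewrite /average_packing -mulr_suml ler_pdivlMr // exchange_big /=.
apply: (@le_trans _ _ (\sum_(A : {set 'I_n} | #|A| == k) k%:R * (k%:R - 1) * g)).
  rewrite sumr_const.
  have -> : #|[pred A : {set 'I_n} | #|A| == k]| = 'C(n, k).
    have := cards_draws (setT : {set 'I_n}) k; rewrite cardsT card_ord => <-.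
    by apply: eq_card => A; rewrite [RHS]inE subsetT.
  have b1 := mul_bin_diag n (k - 1); have b2 := mul_bin_diag n.-1 (k - 2).
  rewrite subn1 prednK ?(ltnW k2) // in b1.
  have e1 : (k - 2).+1 = k.-1 by rewrite -subSn // subSS subn1.
  rewrite e1 -[n.-1.-1]/(n.-2) in b2.
  have e2 : n.-2 = (n - 2)%N by rewrite -subn2.
  rewrite e2 in b2.
  have c1 : n%:R - 1 = n.-1%:R :> R by rewrite -subn1 natrB // (leq_trans _ kn) // ltnW.
  have c2 : k%:R - 1 = k.-1%:R :> R by rewrite -subn1 natrB // ltnW.
  have : n%:R * (n%:R - 1) * D = k%:R * (k%:R - 1) * 'C(n, k)%:R.
    rewrite c1 c2 /D -!natrM -mulnA b2 mulnCA b1.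
    by congr (_%:R); rewrite mulnA [(k.-1 * k)%N]mulnC.
  move=> eq1; rewrite -[_ *+ 'C(n, k)]mulr_natr le_eqVlt; apply/orP; left; apply/eqP.
  by rewrite mulrAC eq1; ring.
by apply: ler_sum => A /eqP; exact: le_g.
Qed.

Lemma triangle_packing (R : archiRealFieldType) (eps : R) : 0 < eps ->
  exists N : nat, forall n : nat, (N <= n)%N -> forall c : colouring n,
  exists S : {set {set 'I_n}}, edm_triangles c S /\
    n%:R ^+ 2 / 12 - eps * n%:R ^+ 2 <= #|S|%:R.
Proof.
move=> eps0; have [big_eps|eps12] := lerP (1 / 12) eps.
  exists 0%N => n _ c; exists set0; split; first by split=> T; rewrite inE.
  have := ler_wpM2r (sqr_ge0 (n%:R : R)) big_eps; rewrite cards0; lra.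
(* Budget: this choice loses [eps / 4] in density, and so does [n0%:R ^+ 2] through the choice of
   [k]. The nibble loses [eps / 2] per edge, again [eps / 4] in density. The last quarter of [eps]
   absorbs the linear term. *)
pose lam : R := 1 / 6 - eps / 2.
have lam0 : 0 <= lam by rewrite /lam; lra.
have [n0 n0P] : exists n0 : nat, 6 < n0%:R * (1 - 6 * lam).
  exists (Num.bound (6 / (3 * eps))).
  have -> : 1 - 6 * lam = 3 * eps by rewrite /lam; lra.
  have p0 : 0 < 3 * eps by rewrite mulr_gt0.
  by rewrite -ltr_pdivrMr // archi_boundP // divr_ge0 // ltW.
have [k [k3 kP]] : exists k : nat, (3 <= k)%N /\
    n0%:R ^+ 2 <= eps / 4 * (k%:R * (k%:R - 1)).
  have q0 : 0 <= n0%:R ^+ 2 / (eps / 4) by rewrite !divr_ge0 ?sqr_ge0 // ltW.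
  exists (Num.bound (n0%:R ^+ 2 / (eps / 4)) + 3)%N; rewrite leq_addl; split=> //.
  have := archi_boundP q0; set b := Num.bound _; rewrite ltr_pdivrMr ?divr_gt0 // => hb.
  rewrite mulrC; apply: le_trans (ltW hb) _; rewrite ler_wpM2r ?divr_ge0 ?ltW //.
  by rewrite natrD; have := ler0n R b; nra.
have eps20 : 0 < eps / 2 by rewrite divr_gt0.
have [delta delta0 nib] := nibble_all eps20.
(* These thresholds ensure that [k]-subsets exist, that the averaged packing is [delta]-spread, and
   that [n / 12] is at most [eps / 4 * n^2]. *)
exists (maxn k (maxn (Num.bound ((k - 2)%:R / delta) + 2) (Num.bound (1 / (3 * eps))))).
move=> n; rewrite !geq_max => /and3P[kn n_delta n_eps] c.
have [W packW leW] : exists2 W : {set 'I_n} -> {set 'I_n} -> R,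
    forall A : {set 'I_n}, fractional_packing c A (W A) &
    forall A : {set 'I_n}, lam / 2 * (#|A|%:R * (#|A|%:R + 1)) - n0%:R ^+ 2 <= \sum_T W A T.
  apply: (@fin_all_exists2 _ (fun=> {set 'I_n} -> R) (fun A w => fractional_packing c A w)
    (fun A w => lam / 2 * (#|A|%:R * (#|A|%:R + 1)) - n0%:R ^+ 2 <= \sum_T w T)) => A.
  exact: fractional_packing_bound.
have le_delta : (k - 2)%:R <= delta * (n - 2)%:R.
  have n2 := leq_sub2r 2 n_delta; rewrite addnK in n2.
  have q0 : 0 <= (k - 2)%:R / delta by apply: divr_ge0; [exact: ler0n|exact: ltW].
  rewrite mulrC -ler_pdivrMr //; apply/ltW/(lt_le_trans (archi_boundP q0)).
  by rewrite ler_nat.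
have sp := average_spread k3 kn le_delta packW.
have [M [Mw Md Mc]] := nib _ _ _ _ _ sp.
exists M; split.
  split=> [T TM|T1 T2 T1M T2M T12].
    have : average_packing k W T != 0 by apply: lt0r_neq0; exact: Mw.
    apply: contraNT => Tm; rewrite /average_packing big1 ?mul0r // => A _.
    have [_ W_out _] := packW A; apply: W_out.
    by rewrite inE negb_and Tm orbT.
  apply/forallP => e; apply/implyP => e2; apply/negP => /andP[e1 e1'].
  have /pred0P/(_ e) := Md T1 T2 T1M T2M T12.
  by rewrite /= !inE e1 e1' e2.
apply: le_trans Mc.
have le_sum : n%:R * (n%:R - 1) * (1 / 12 - eps / 2) <= \sum_T average_packing k W T.
  apply: (sum_average (ltnW k3) kn) => A Ak; apply: le_trans (leW A); rewrite Ak.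
  have k0 : 0 <= k%:R :> R by exact: ler0n.
  have := mulr_ge0 lam0 k0; rewrite /lam in lam0 *; move: kP; clear; lra.
have := bin2_natr R #|[set: 'I_n]|; rewrite -card_edges cardsT card_ord => edgesE.
have n_big : 1 <= n%:R * (3 * eps).
  have p0 : 0 < 3 * eps by rewrite mulr_gt0.
  rewrite -ler_pdivrMr //; apply: ltW; apply: lt_le_trans (archi_boundP _) _.
    by rewrite divr_ge0 // ltW.
  by rewrite ler_nat.
have := ler_wpM2l (ler0n R n) n_big.
have := mulr_ge0 (ler0n R n) (ltW eps0).
have := congr1 (fun z => eps * z) edgesE.
by move: le_sum; clear; set E := #|edges _|%:R; lra.
Qed.

Local Close Scope ring_scope.

(* For every eps > 0 and all sufficiently large n, every 2-colouring of the
   edges of K_n has at least n^2/12 - eps*n^2 pairwise edge-disjoint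
   monochromatic triangles. *)
Theorem theorem1p2 :
  forall eps : rat, (0 < eps)%R ->
  exists N : nat, forall n : nat, (N <= n)%N ->
  forall c : colouring n,
  exists S : {set {set 'I_n}},
    edm_triangles c S /\
    ((n%:R ^+ 2 / 12%:R - eps * n%:R ^+ 2)%R <= (#|S|%:R : rat))%R.
Proof. exact: triangle_packing. Qed.
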